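(* Let $X,Y$ be computable Banach spaces, both different from $\{0\}$. Then $\mathsf{UBT}_{X,Y}\equiv_W\mathsf{C_{\mathbb N}}$.
   Context: A represented space is a pair $(X,\delta_X)$ with $\delta_X:\subseteq\mathbb N^{\mathbb N}\to X$ a partial surjection. For a partial multi-valued map $f:\subseteq X\rightrightarrows Y$ between represented spaces, a realizer of $f$ is a partial function $F:\subseteq\mathbb N^{\mathbb N}\to\mathbb N^{\mathbb N}$ with $\delta_Y(F(p))\in f(\delta_X(p))$ for all $p\in\mathrm{dom}(f\circ\delta_X)$. We write $f\le_W g$ (Weihrauch reducibility) if there are computable partial functions $H,K:\subseteq\mathbb N^{\mathbb N}\to\mathbb N^{\mathbb N}$ such that for every realizer $G$ of $g$ the function $p\mapsto H\langle p,G(K(p))\rangle$ is a realizer of $f$, where $\langle\cdot,\cdot\rangle$ is a standard computable pairing on $\mathbb N^{\mathbb N}$. $\equiv_W$ is the induced equivalence. $\mathcal A_-(\mathbb N)$ is the set of subsets of $\mathbb N$, where $p$ names $A$ iff $\mathbb N\setminus A=\{n:n+1\in\mathrm{range}(p)\}$; $\mathsf{C_{\mathbb N}}:\subseteq\mathcal A_-(\mathbb N)\rightrightarrows\mathbb N$, $A\mapsto A$, on non-empty $A$. A computable Banach space is a (real) Banach space together with a sequence whose linear span is dense, such that the induced metric space is a complete computable metric space; points are represented by the Cauchy representation $\delta_X$. $\mathcal C(X,Y)$ is the space of continuous $T:X\to Y$ with the function space representation $[\delta_X\to\delta_Y]$, and sequences are represented by tupling. $\mathsf{UBT}_{X,Y}:\subseteq\mathcal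 C(X,Y)^{\mathbb N}\rightrightarrows\mathbb N$, $(T_i)_i\mapsto\{M\in\mathbb N:\sup_i\|T_i\|\le M\}$, defined on all sequences of linear bounded operators $T_i:X\to Y$ such that $\{\|T_ix\|:i\in\mathbb N\}$ is bounded for every $x\in X$. *)

(* Defs.v *)
From Stdlib Require Import Reals List QArith Qreals Cantor PeanoNat ZArith.
Import ListNotations.
Open Scope R_scope.

Definition Baire := nat -> nat.

Definition npair (a b : nat) : nat := Cantor.to_nat (a, b).

Definition bpair (p q : Baire) : Baire :=
  fun n => if Nat.even n then p (Nat.div2 n) else q (Nat.div2 n).

Definition bproj (p : Baire) (i : nat) : Baire := fun n => p (npair i n).

Fixpoint enc_list (l : list nat) : nat :=
  match l with
  | [] => 0%nat
  | a :: l' => S (Cantor.to_nat (a, enc_list l'))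
  end.

Fixpoint dec_list_fuel (fuel n : nat) : list nat :=
  match fuel with
  | O => []
  | S f => match n with
           | O => []
           | S m => let (a, b) := Cantor.of_nat m in a :: dec_list_fuel f b
           end
  end.
Definition dec_list (n : nat) : list nat := dec_list_fuel n n.

Definition dec_Z (a : nat) : Z :=
  if Nat.even a then Z.of_nat (Nat.div2 a) else (- Z.of_nat (Nat.div2 (S a)))%Z.
Definition dec_Q (n : nat) : Q :=
  let (a, b) := Cantor.of_nat n in Qmake (dec_Z a) (Pos.of_nat (S b)).

Inductive code : Type :=
| cZero : code
| cSucc : code
| cProj : nat -> code
| cOrc  : code
| cComp : code -> list code -> code
| cPrec : code -> code -> code
| cMu   : code -> code.

Inductive ev (p : Baire) : code -> list nat -> nat -> Prop :=
| evZero xs : ev p cZero xs 0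
| evSucc xs : ev p cSucc xs (S (hd 0%nat xs))
| evProj i xs : ev p (cProj i) xs (nth i xs 0%nat)
| evOrc xs : ev p cOrc xs (p (hd 0%nat xs))
| evComp f gs xs ys v : evs p gs xs ys -> ev p f ys v -> ev p (cComp f gs) xs v
| evPrec0 f g xs v : ev p f xs v -> ev p (cPrec f g) (0%nat :: xs) v
| evPrecS f g n xs a v :
    ev p (cPrec f g) (n :: xs) a -> ev p g (n :: a :: xs) v ->
    ev p (cPrec f g) (S n :: xs) v
| evMu f xs k :
    ev p f (k :: xs) 0%nat ->
    (forall j, (j < k)%nat -> exists w, ev p f (j :: xs) (S w)) ->
    ev p (cMu f) xs k
with evs (p : Baire) : list code -> list nat -> list nat -> Prop :=
| evsNil xs : evs p [] xs []
| evsCons g gs xs v vs : ev p g xs v -> evs p gs xs vs -> evs p (g :: gs) xs (v :: vs).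

Definition pfun := Baire -> option Baire.

Definition computable_pfun (F : pfun) : Prop :=
  exists c : code, forall p q, F p = Some q -> forall n, ev p c [n] (q n).

Definition comp_fun3 (f : nat -> nat -> nat -> nat) : Prop :=
  exists c : code, forall i j k, ev (fun _ => 0%nat) c [i; j; k] (f i j k).

(* delta p x  :<->  p is a name of x  (a partial map B -> X as a relation) *)
Record RepSpace := {
  rs_car :> Type;
  rs_del : Baire -> rs_car -> Prop
}.

Record MVMap (X Y : RepSpace) := {
  mv_dom : rs_car X -> Prop;
  mv_val : rs_car X -> rs_car Y -> Prop
}.
Arguments mv_dom {X Y}.
Arguments mv_val {X Y}.

Definition realizer {X Y : RepSpace} (f : MVMap X Y) (F : pfun) : Prop :=
  forall p x, rs_del X p x -> mv_dom f x ->
    exists q, F p = Some q /\ exists y, rs_del Y q y /\ mv_val f x y.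

Definition obind (o : option Baire) (k : Baire -> option Baire) : option Baire :=
  match o with Some a => k a | None => None end.

Definition weihrauch_le {X Y Z W : RepSpace} (f : MVMap X Y) (g : MVMap Z W) : Prop :=
  exists H K : pfun, computable_pfun H /\ computable_pfun K /\
    forall G : pfun, realizer g G ->
      realizer f (fun p => obind (K p) (fun k => obind (G k) (fun r => H (bpair p r)))).

Definition weihrauch_eq {X Y Z W : RepSpace} (f : MVMap X Y) (g : MVMap Z W) : Prop :=
  weihrauch_le f g /\ weihrauch_le g f.

Definition RS_nat : RepSpace := {| rs_car := nat; rs_del := fun p n => p 0%nat = n |}.

Definition RS_Aminus : RepSpace :=
  {| rs_car := nat -> Prop;
     rs_del := fun p A => forall n, ~ A n <-> exists k, p k = S n |}.

Definition C_N : MVMap RS_Aminus RS_nat :=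
  @Build_MVMap RS_Aminus RS_nat (fun A : nat -> Prop => exists n, A n)
    (fun (A : nat -> Prop) (n : nat) => A n).

Record CompBanach := {
  cb_V :> Type;
  cb_zero : cb_V;
  cb_add : cb_V -> cb_V -> cb_V;
  cb_opp : cb_V -> cb_V;
  cb_scal : R -> cb_V -> cb_V;
  cb_norm : cb_V -> R;
  cb_addA : forall x y z, cb_add x (cb_add y z) = cb_add (cb_add x y) z;
  cb_addC : forall x y, cb_add x y = cb_add y x;
  cb_add0 : forall x, cb_add x cb_zero = x;
  cb_addN : forall x, cb_add x (cb_opp x) = cb_zero;
  cb_scal1 : forall x, cb_scal 1 x = x;
  cb_scalA : forall a b x, cb_scal a (cb_scal b x) = cb_scal (a * b) x;
  cb_scalDl : forall a b x, cb_scal (a + b) x = cb_add (cb_scal a x) (cb_scal b x);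
  cb_scalDr : forall a x y, cb_scal a (cb_add x y) = cb_add (cb_scal a x) (cb_scal a y);
  cb_norm0 : forall x, cb_norm x = 0 <-> x = cb_zero;
  cb_normZ : forall a x, cb_norm (cb_scal a x) = Rabs a * cb_norm x;
  cb_normD : forall x y, cb_norm (cb_add x y) <= cb_norm x + cb_norm y;
  cb_complete : forall u : nat -> cb_V,
    (forall eps, 0 < eps -> exists N, forall m n, (N <= m)%nat -> (N <= n)%nat ->
        cb_norm (cb_add (u m) (cb_opp (u n))) < eps) ->
    exists l, forall eps, 0 < eps -> exists N, forall n, (N <= n)%nat ->
        cb_norm (cb_add (u n) (cb_opp l)) < eps;
  cb_e : nat -> cb_V;
  cb_span_dense : forall x eps, 0 < eps -> exists (k : nat) (c : nat -> R),
    cb_norm (cb_add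
      (fold_right cb_add cb_zero (map (fun i => cb_scal (c i) (cb_e i)) (seq 0 k)))
      (cb_opp x)) < eps;
  (* the induced metric space (X, d, alpha) is a computable metric space:
     d(alpha i, alpha j) is uniformly computable, where alpha enumerates the
     rational linear combinations of cb_e (see cb_alpha below) *)
  cb_dist_comp : exists f : nat -> nat -> nat -> nat, comp_fun3 f /\
    forall i j k,
      let ai := fold_right cb_add cb_zero
            (map (fun '(m, q) => cb_scal (Q2R (dec_Q q)) (cb_e m))
                 (combine (seq 0 (length (dec_list i))) (dec_list i))) in
      let aj := fold_right cb_add cb_zero
            (map (fun '(m, q) => cb_scal (Q2R (dec_Q q)) (cb_e m))
                 (combine (seq 0 (length (dec_list j))) (dec_list j))) in
      Rabs (Q2R (dec_Q (f i j k)) - cb_norm (cb_add ai (cb_opp aj))) <= / 2 ^ k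
}.

Definition cb_alpha (X : CompBanach) (n : nat) : X :=
  fold_right (cb_add X) (cb_zero X)
    (map (fun '(m, q) => cb_scal X (Q2R (dec_Q q)) (cb_e X m))
         (combine (seq 0 (length (dec_list n))) (dec_list n))).

Definition cb_dist (X : CompBanach) (x y : X) : R := cb_norm X (cb_add X x (cb_opp X y)).

Definition delta_Cauchy (X : CompBanach) (p : Baire) (x : X) : Prop :=
  forall n, cb_dist X (cb_alpha X (p n)) x <= / 2 ^ n.

(* Standard representation eta of continuous partial functions on Baire space
   via (Kleene) associates:  eta_p(q)(n) = m  iff for the least k with
   p(<n, code(q[0..k))>) <> 0 we have p(<n, code(q[0..k))>) = m + 1. *)
Definition prefix (q : Baire) (k : nat) : list nat := map q (seq 0 k).
Definition eta_val (p q : Baire) (n m : nat) : Prop :=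
  exists k, p (npair n (enc_list (prefix q k))) = S m /\
    forall k', (k' < k)%nat -> p (npair n (enc_list (prefix q k'))) = 0%nat.
Definition eta (p q r : Baire) : Prop := forall n, eta_val p q n (r n).

Definition delta_fun (X Y : CompBanach) (p : Baire) (T : X -> Y) : Prop :=
  forall q x, delta_Cauchy X q x ->
    exists r, eta p q r /\ delta_Cauchy Y r (T x).

Definition RS_opseq (X Y : CompBanach) : RepSpace :=
  {| rs_car := nat -> (X -> Y);
     rs_del := fun p T => forall i, delta_fun X Y (bproj p i) (T i) |}.

Definition is_linear (X Y : CompBanach) (T : X -> Y) : Prop :=
  (forall x y, T (cb_add X x y) = cb_add Y (T x) (T y)) /\
  (forall a x, T (cb_scal X a x) = cb_scal Y a (T x)).

Definition is_bounded (X Y : CompBanach) (T : X -> Y) : Prop :=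
  exists c, forall x, cb_norm Y (T x) <= c * cb_norm X x.

(* UBT_{X,Y}: (T_i) |-> { M in N | sup_i ||T_i|| <= M }, where
   ||T|| = sup_{||x|| <= 1} ||T x||; sup_i ||T_i|| <= M is spelled out. *)
Definition UBT (X Y : CompBanach) : MVMap (RS_opseq X Y) RS_nat :=
  @Build_MVMap (RS_opseq X Y) RS_nat (fun T : nat -> (X -> Y) =>
       (forall i, is_linear X Y (T i) /\ is_bounded X Y (T i)) /\
       (forall x, exists b, forall i, cb_norm Y (T i x) <= b))
    (fun (T : nat -> (X -> Y)) (M : nat) =>
       forall i x, cb_norm X x <= 1 -> cb_norm Y (T i x) <= INR M).

(* Main.v *)
Require Import Defs.
From Stdlib Require Import Reals List QArith Qreals Cantor PeanoNat ZArith.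
From Stdlib Require Import Lia Lra Psatz Classical ClassicalEpsilon FunctionalExtensionality.
Import ListNotations.

(* C_N reduces to UBT through a computable nonzero functional phi on X: the Gateaux derivative
   of the norm at a point u. The points where the norm is 2^-k-smooth in direction alpha_m
   form a dense open set, because second differences of the norm along a line telescope;
   an effective Baire category argument then produces u as the limit of balls found by search,
   together with a step size that bounds the error of the difference quotients, so that phi is
   computable. For a name p of a closed set, let T_i x = c_i phi(x) y, with |y| >= 1 and
   c_i = i + 1 if stage i of p refutes the least number not refuted before, c_i = 0 otherwise.
   Any bound M on the norms bounds the last change of that guess, so the guess at stage M
   belongs to the set.
   Conversely, by the uniform boundedness theorem the bounds of (T_i) form a nonempty set, and
   M is refuted by some rational alpha_j with |alpha_j| < 1 and |T_i alpha_j| > M. *)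

(** * Recursive functions and their codes *)

Local Open Scope nat_scope.

(** The functional is the hard part of the reduction from [C_N]: the Hahn-Banach theorem provides
    functionals, but no way to compute their values. At a smooth point the values can be enclosed.
    The quotients (|u + t x| - |u|) / t decrease to the one-sided derivative at [x] as [t] tends to
    0, those for [-x] bound it from below after a change of sign, and the gap between the two bounds
    is the second difference of the norm divided by [t]. A small second difference at a single [t]
    thus certifies an approximation, and certificates can be searched for because norms of dense
    points are computable. That the gap tends to 0 also makes the derivative, in general only
    sublinear, odd and hence linear. The height [i + 1] of a change at stage [i] exceeds [i], so a
    bound [M] excludes changes at all stages from [M] on. Data that depend only on the spaces, such
    as a starting ball and the vector [y], are built into the codes, since the equivalence is
    claimed for each pair of spaces separately. *)

(** Made total by [epsilon], so that searches can occur inside ordinary terms. The value is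
    meaningful only where [f] has a zero, which [ev_mu] therefore asks for. *)
Definition least (f : nat -> nat) : nat :=
  epsilon (inhabits 0) (fun k => f k = 0 /\ forall j, j < k -> f j <> 0).

Lemma least_spec (f : nat -> nat) :
  (exists k, f k = 0) -> f (least f) = 0 /\ forall j, j < least f -> f j <> 0.
Proof.
  intros [k Hk]. unfold least. apply epsilon_spec.
  revert Hk. induction k as [k IH] using lt_wf_ind. intros Hk.
  destruct (classic (exists j, j < k /\ f j = 0)) as [(j & Hj & Hf)|H].
  - exact (IH j Hj Hf).
  - exists k. split; [exact Hk|]. intros j Hj Hf. apply H. now exists j.
Qed.

Lemma ev_proj_at p xs i v : nth i xs 0 = v -> ev p (cProj i) xs v.
Proof. intros <-. constructor. Qed.

Fixpoint cConst (n : nat) : code :=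
  match n with O => cZero | S m => cComp cSucc [cConst m] end.

Lemma ev_comp1 (p : Baire) cf f xs c a :
  (forall x, ev p cf [x] (f x)) -> ev p c xs a -> ev p (cComp cf [c]) xs (f a).
Proof. intros Hf Ha. eapply evComp; [|apply Hf]. repeat constructor; assumption. Qed.

Lemma ev_comp2 (p : Baire) cf f xs c1 c2 a b :
  (forall x y, ev p cf [x; y] (f x y)) -> ev p c1 xs a -> ev p c2 xs b ->
  ev p (cComp cf [c1; c2]) xs (f a b).
Proof. intros Hf Ha Hb. eapply evComp; [|apply Hf]. repeat constructor; assumption. Qed.

Lemma ev_comp3 (p : Baire) cf f xs c1 c2 c3 a b d :
  (forall x y z, ev p cf [x; y; z] (f x y z)) ->
  ev p c1 xs a -> ev p c2 xs b -> ev p c3 xs d ->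
  ev p (cComp cf [c1; c2; c3]) xs (f a b d).
Proof. intros Hf Ha Hb Hd. eapply evComp; [|apply Hf]. repeat constructor; assumption. Qed.

Lemma ev_succ p xs c a : ev p c xs a -> ev p (cComp cSucc [c]) xs (S a).
Proof. apply (ev_comp1 p cSucc S). intros x. apply (evSucc p [x]). Qed.

Lemma ev_orc p xs c a : ev p c xs a -> ev p (cComp cOrc [c]) xs (p a).
Proof. apply (ev_comp1 p cOrc p). intros x. apply (evOrc p [x]). Qed.

Lemma ev_const p xs n : ev p (cConst n) xs n.
Proof. induction n; cbn; [constructor|]. now apply ev_succ. Qed.

Lemma evs_vars p xs pre :
  evs p (map cProj (seq (length pre) (length xs))) (pre ++ xs) xs.
Proof.
  revert pre. induction xs as [|x xs IH]; intros pre; cbn; [constructor|].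
  constructor.
  - apply ev_proj_at. rewrite app_nth2; [|lia]. now rewrite Nat.sub_diag.
  - specialize (IH (pre ++ [x])). rewrite length_app, <- app_assoc in IH.
    now rewrite Nat.add_1_r in IH.
Qed.

(** [cPrec] sees only its own arguments, so the variables in scope are handed over unchanged by a
    block of projections behind the recursion argument. *)
Lemma ev_rec p xs n cb cs cn b step m :
  length xs = n -> ev p cb xs b -> (forall k a, ev p cs (k :: a :: xs) (step k a)) ->
  ev p cn xs m ->
  ev p (cComp (cPrec cb cs) (cn :: map cProj (seq 0 n))) xs
     (nat_rect (fun _ => nat) b step m).
Proof.
  intros <- Hb Hs Hm. eapply evComp.
  - constructor; [exact Hm|]. apply (evs_vars p xs []).
  - clear Hm. induction m; cbn; econstructor; eauto.
Qed.

Lemma ev_mu p xs cf f :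
  (forall k, ev p cf (k :: xs) (f k)) -> (exists k, f k = 0) ->
  ev p (cMu cf) xs (least f).
Proof.
  intros Hf Hex. destruct (least_spec f Hex) as [H0 H1]. constructor.
  - rewrite <- H0. apply Hf.
  - intros j Hj. specialize (H1 j Hj). specialize (Hf j).
    destruct (f j) as [|w]; [easy|]. now exists w.
Qed.

Ltac ev_var :=
  match goal with
  | |- ev _ _ [] _ => fail 1
  | |- ev _ _ ?xs ?v =>
      let rec go l i := lazymatch l with
        | v :: _ => exact (ev_proj_at _ xs i v eq_refl)
        | _ :: ?l' => go l' (S i)
        end in go xs 0
  end.

(** One code serves all oracles, hence it can be used inside any other program. Sigma types let
    [ev_named] project the code out of what instance search finds. *)
Definition code1 (f : nat -> nat) := {c | forall p x, ev p c [x] (f x)}.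
Definition code2 (f : nat -> nat -> nat) := {c | forall p x y, ev p c [x; y] (f x y)}.
Definition code3 (f : nat -> nat -> nat -> nat) :=
  {c | forall p x y z, ev p c [x; y; z] (f x y z)}.
Existing Class code1.
Existing Class code2.
Existing Class code3.

Ltac ev_named :=
  match goal with
  | |- ev _ _ _ (?f _) =>
      eapply (ev_comp1 _ _ _ _ _ _ (proj2_sig (ltac:(typeclasses eauto) : code1 f) _))
  | |- ev _ _ _ (?f _ _) =>
      eapply (ev_comp2 _ _ _ _ _ _ _ _ (proj2_sig (ltac:(typeclasses eauto) : code2 f) _))
  | |- ev _ _ _ (?f _ _ _) =>
      eapply (ev_comp3 _ _ _ _ _ _ _ _ _ _ (proj2_sig (ltac:(typeclasses eauto) : code3 f) _))
  end.
(** The constant case cannot misfire: the code is an existential variable created before the oracle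
    and the inputs are introduced, so it cannot become a constant that depends on them. *)
Ltac ev_step :=
  first
  [ ev_var
  | ev_named
  | lazymatch goal with |- ev _ _ _ (S _) => eapply ev_succ end
  | lazymatch goal with |- ev _ _ _ (nat_rect _ _ _ _) =>
      eapply ev_rec; [cbn; reflexivity| |intros ? ?; cbv beta|] end
  | lazymatch goal with |- ev _ _ _ (least _) =>
      eapply ev_mu; [intros ?; cbv beta|] end
  | eapply ev_const
  | match goal with |- ev ?p _ _ (?q _) => constr_eq p q; eapply ev_orc end
  ].
(* Builds the code [?c] of a goal [ev p ?c xs v] by recursion on the term [v]; recursion and
   minimisation push their bound variables on [xs]. *)
Ltac ev_auto := repeat (lazymatch goal with |- ev _ _ _ _ => ev_step end).

(** * Codes for arithmetic and for the Cantor pairing *)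

#[local] Instance pred_code : code1 Nat.pred.
Proof.
  eexists; intros p x.
  replace (Nat.pred x) with (nat_rect (fun _ => nat) 0 (fun k _ => k) x) by now destruct x.
  ev_auto.
Qed.
#[local] Instance add_code : code2 Nat.add.
Proof.
  eexists; intros p x y.
  replace (x + y) with (nat_rect (fun _ => nat) y (fun _ a => S a) x)
    by (induction x; cbn; congruence).
  ev_auto.
Qed.
#[local] Instance sub_code : code2 Nat.sub.
Proof.
  eexists; intros p x y.
  replace (x - y) with (nat_rect (fun _ => nat) x (fun _ a => Nat.pred a) y)
    by (induction y; cbn; lia).
  ev_auto.
Qed.
#[local] Instance mul_code : code2 Nat.mul.
Proof.
  eexists; intros p x y.
  replace (x * y) with (nat_rect (fun _ => nat) 0 (fun _ a => y + a) x)
    by (induction x; cbn; congruence).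
  ev_auto.
Qed.
#[local] Instance pow2_code : code1 (Nat.pow 2).
Proof.
  eexists; intros p x.
  replace (2 ^ x) with (nat_rect (fun _ => nat) 1 (fun _ a => a + a) x)
    by (induction x; cbn; lia).
  ev_auto.
Qed.
#[local] Instance npair_code : code2 npair.
Proof.
  eexists; intros p x y. unfold npair, to_nat, nat_rec. ev_auto.
Qed.

Definition ufst (n : nat) : nat := fst (of_nat n).
Definition usnd (n : nat) : nat := snd (of_nat n).

Lemma ufst_npair a b : ufst (npair a b) = a.
Proof. unfold ufst, npair. now rewrite cancel_of_to. Qed.
Lemma usnd_npair a b : usnd (npair a b) = b.
Proof. unfold usnd, npair. now rewrite cancel_of_to. Qed.
Lemma npair_unpair n : npair (ufst n) (usnd n) = n.
Proof. unfold ufst, usnd, npair. now rewrite <- surjective_pairing, cancel_to_of. Qed.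

Definition tri (n : nat) : nat := nat_rect (fun _ => nat) 0 (fun k a => S k + a) n.
Lemma npair_tri a b : npair a b = b + tri (b + a).
Proof. reflexivity. Qed.
Lemma tri_S n : tri (S n) = S n + tri n.
Proof. reflexivity. Qed.
#[local] Instance tri_code : code1 tri.
Proof. eexists; intros p x. unfold tri. ev_auto. Qed.
Lemma tri_mono a b : a <= b -> tri a <= tri b.
Proof. induction 1; rewrite ?tri_S; lia. Qed.

(** Inversion of the pairing: [n] lies on the diagonal [s] with [tri s <= n < tri (S s)], and the
    truncated difference vanishes exactly when [n < tri (S s)]. Both projections are then computed
    from this search. *)
Lemma usum_least n : ufst n + usnd n = least (fun s => S n - tri (S s)).
Proof.
  assert (Hn := npair_unpair n). rewrite npair_tri in Hn.
  set (a := ufst n) in *. set (b := usnd n) in *.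
  destruct (least_spec (fun s => S n - tri (S s))) as [H0 H1].
  { exists (b + a). rewrite tri_S. lia. }
  set (m := least _) in *. cbv beta in H0.
  assert (m <= b + a).
  { destruct (Nat.le_gt_cases m (b + a)) as [H|H]; [exact H|].
    exfalso. apply (H1 (b + a) H). rewrite tri_S. lia. }
  destruct (Nat.eq_dec m (b + a)) as [->|]; [lia|].
  assert (T := tri_mono (S m) (b + a) ltac:(lia)). lia.
Qed.

#[local] Instance usnd_code : code1 usnd.
Proof.
  eexists; intros p n.
  replace (usnd n) with (n - tri (least (fun s => S n - tri (S s)))).
  - ev_auto. exists (ufst n + usnd n).
    assert (Hn := npair_unpair n). rewrite npair_tri in Hn. rewrite Nat.add_comm, tri_S. lia.
  - rewrite <- usum_least. assert (Hn := npair_unpair n). rewrite npair_tri in Hn.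
    rewrite (Nat.add_comm (ufst n)). lia.
Qed.

#[local] Instance ufst_code : code1 ufst.
Proof.
  eexists; intros p n.
  replace (ufst n) with (least (fun s => S n - tri (S s)) - usnd n).
  - ev_auto. exists (ufst n + usnd n).
    assert (Hn := npair_unpair n). rewrite npair_tri in Hn. rewrite Nat.add_comm, tri_S. lia.
  - rewrite <- usum_least. lia.
Qed.

Definition evenb (n : nat) : nat := if Nat.even n then 1 else 0.
#[local] Instance evenb_code : code1 evenb.
Proof.
  eexists; intros p n.
  replace (evenb n) with (nat_rect (fun _ => nat) 1 (fun _ a => 1 - a) n).
  - ev_auto.
  - induction n as [|n IH]; [reflexivity|]. cbn [nat_rect]. rewrite IH. unfold evenb.
    rewrite Nat.even_succ, <- Nat.negb_even. now destruct (Nat.even n).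
Qed.

#[local] Instance div2_code : code1 Nat.div2.
Proof.
  eexists; intros p n.
  replace (Nat.div2 n) with (nat_rect (fun _ => nat) 0 (fun k a => a + (1 - evenb k)) n).
  - ev_auto.
  - induction n as [|n IH]; [reflexivity|]. cbn [nat_rect]. rewrite IH.
    assert (H1 := Nat.div2_odd n). assert (H2 := Nat.div2_odd (S n)).
    rewrite <- Nat.negb_even in H1, H2. rewrite Nat.even_succ, <- Nat.negb_even in H2.
    unfold evenb. destruct (Nat.even n); cbn in H1, H2 |- *; lia.
Qed.

(* The integer coded by [a] is [zpos a - zneg a]; [zmk] codes a difference. *)
Definition zpos (a : nat) : nat := evenb a * Nat.div2 a.
Definition zneg (a : nat) : nat := (1 - evenb a) * Nat.div2 (S a).
Definition zmk (P N : nat) : nat := 2 * (P - N) + (2 * (N - P) - 1).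
#[local] Instance zpos_code : code1 zpos.
Proof. eexists; intros p x. unfold zpos. ev_auto. Qed.
#[local] Instance zneg_code : code1 zneg.
Proof. eexists; intros p x. unfold zneg. ev_auto. Qed.
#[local] Instance zmk_code : code2 zmk.
Proof. eexists; intros p x y. unfold zmk. ev_auto. Qed.

Lemma dec_Z_posneg a : dec_Z a = (Z.of_nat (zpos a) - Z.of_nat (zneg a))%Z.
Proof. unfold dec_Z, zpos, zneg, evenb. destruct (Nat.even a); lia. Qed.

Lemma dec_Z_zmk P N : dec_Z (zmk P N) = (Z.of_nat P - Z.of_nat N)%Z.
Proof.
  unfold dec_Z, zmk. destruct (Nat.le_gt_cases N P) as [H|H].
  - replace (2 * (P - N) + (2 * (N - P) - 1)) with (2 * (P - N)) by lia.
    rewrite Nat.even_even, Nat.div2_double. lia.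
  - replace (2 * (P - N) + (2 * (N - P) - 1)) with (S (2 * (N - P - 1))) by lia.
    rewrite Nat.even_succ, <- Nat.negb_even, Nat.even_even. cbn [negb].
    replace (S (S (2 * (N - P - 1)))) with (2 * (N - P)) by lia.
    rewrite Nat.div2_double. lia.
Qed.

(** * Arithmetic of coded rationals *)

Definition qval (q : nat) : R := Q2R (dec_Q q).
Definition qmk (P N d : nat) : nat := npair (zmk P N) (d - 1).
#[local] Instance qmk_code : code3 qmk.
Proof. eexists; intros p x y z. unfold qmk. ev_auto. Qed.

Lemma qval_frac q :
  qval q = ((INR (zpos (ufst q)) - INR (zneg (ufst q))) / INR (S (usnd q)))%R.
Proof.
  unfold qval, dec_Q, ufst, usnd. destruct (of_nat q) as [a b]. cbn [fst snd].
  unfold Q2R. cbn [Qnum Qden]. rewrite dec_Z_posneg, minus_IZR, <- !INR_IZR_INZ.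
  unfold Rdiv. do 2 f_equal. rewrite INR_IZR_INZ. f_equal.
  rewrite <- (Nat2Pos.id (S b)) at 2 by easy. now rewrite positive_nat_Z.
Qed.

Lemma qval_qmk P N d : 0 < d -> qval (qmk P N d) = ((INR P - INR N) / INR d)%R.
Proof.
  intros Hd. unfold qval, qmk, dec_Q, npair. rewrite cancel_of_to.
  unfold Q2R. cbn [Qnum Qden]. rewrite dec_Z_zmk, minus_IZR, <- !INR_IZR_INZ.
  unfold Rdiv. do 2 f_equal. rewrite INR_IZR_INZ. f_equal.
  replace (S (d - 1)) with d by lia.
  rewrite <- (Nat2Pos.id d) at 2 by lia. now rewrite positive_nat_Z.
Qed.

(** Positive and negative parts of the numerators are kept apart, so that signed arithmetic stays
    within [nat]; [qval_qlin] gives the meaning. *)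
Definition qlin (a q b : nat) : nat :=
  let Pa := zpos (ufst a) in let Na := zneg (ufst a) in let da := S (usnd a) in
  let Pb := zpos (ufst b) in let Nb := zneg (ufst b) in let db := S (usnd b) in
  let Pq := zpos (ufst q) in let Nq := zneg (ufst q) in let dq := S (usnd q) in
  qmk (Pa * (dq * db) + da * (Pq * Pb + Nq * Nb))
      (Na * (dq * db) + da * (Pq * Nb + Nq * Pb)) (da * (dq * db)).
#[local] Instance qlin_code : code3 qlin.
Proof. eexists; intros p x y z. unfold qlin. ev_auto. Qed.

Lemma qval_qlin a q b : qval (qlin a q b) = (qval a + qval q * qval b)%R.
Proof.
  unfold qlin. rewrite qval_qmk by lia. rewrite !(qval_frac _).
  repeat rewrite ?plus_INR, ?mult_INR. field.
  repeat split; now apply not_0_INR.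
Qed.

(** * Coded lists *)

Definition ntl (n : nat) : nat := usnd (Nat.pred n).
Definition nhd (n : nat) : nat := ufst (Nat.pred n).
Definition ndrop (n i : nat) : nat := nat_rect (fun _ => nat) n (fun _ a => ntl a) i.
Definition nnth (n i : nat) : nat := nhd (ndrop n i).
#[local] Instance ntl_code : code1 ntl.
Proof. eexists; intros p x. unfold ntl. ev_auto. Qed.
#[local] Instance nhd_code : code1 nhd.
Proof. eexists; intros p x. unfold nhd. ev_auto. Qed.
#[local] Instance ndrop_code : code2 ndrop.
Proof. eexists; intros p x y. unfold ndrop. ev_auto. Qed.
#[local] Instance nnth_code : code2 nnth.
Proof. eexists; intros p x y. unfold nnth. ev_auto. Qed.

Definition build (g : nat -> nat) (L : nat) : nat :=
  nat_rect (fun _ => nat) 0 (fun k a => S (npair (g (L - S k)) a)) L.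

(** Length [i + j] suffices because a coded list is never longer than its code; missing entries read
    as 0, which also codes the rational 0. *)
Definition lc (i q j : nat) : nat :=
  build (fun l => qlin (nnth i l) q (nnth j l)) (i + j).
#[local] Instance lc_code : code3 lc.
Proof. eexists; intros p x y z. unfold lc, build. ev_auto. Qed.

Lemma ndrop_S n i : ndrop n (S i) = ndrop (ntl n) i.
Proof. unfold ndrop. induction i as [|i IH]; cbn [nat_rect] in *; congruence. Qed.
Lemma nnth_S n i : nnth n (S i) = nnth (ntl n) i.
Proof. unfold nnth. now rewrite ndrop_S. Qed.
Lemma nnth_0l i : nnth 0 i = 0.
Proof. induction i; [reflexivity|]. rewrite nnth_S. exact IHi. Qed.

Lemma nnth_build g L l : l < L -> nnth (build g L) l = g l.
Proof.
  unfold build. set (step := fun k a => _).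
  (* After [k] stages the list holds the last [k] of the [L] values, since lists grow at the
     head. *)
  assert (H : forall k l, k <= L -> l < k ->
    nnth (nat_rect (fun _ => nat) 0 step k) l = g (L - k + l)).
  { clear l. induction k as [|k IH]; intros l Hk Hl; [lia|].
    cbn [nat_rect]. unfold step at 1. destruct l as [|l].
    - unfold nnth, ndrop, nhd. cbn [nat_rect Nat.pred]. rewrite ufst_npair. f_equal; lia.
    - rewrite nnth_S. unfold ntl. cbn [Nat.pred]. rewrite usnd_npair, IH by lia.
      f_equal. lia. }
  intros Hl. rewrite H by lia. f_equal. lia.
Qed.

Lemma ntl_lt n : 0 < n -> ntl n < n.
Proof.
  intros Hn. unfold ntl. assert (H := npair_unpair (Nat.pred n)). rewrite npair_tri in H. lia.
Qed.
Lemma ntl_le n m : n <= S m -> ntl n <= m.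
Proof.
  intros H. destruct n; [cbn; lia|]. assert (L := ntl_lt (S n) ltac:(lia)). lia.
Qed.

Lemma dec_list_fuel_nth f : forall n i, n <= f -> nth i (dec_list_fuel f n) 0 = nnth n i.
Proof.
  induction f as [|f IH]; intros n i Hn.
  - replace n with 0 by lia. cbn [dec_list_fuel]. rewrite nnth_0l. now destruct i.
  - destruct n as [|n]; cbn [dec_list_fuel]; [rewrite nnth_0l; now destruct i|].
    replace (of_nat n) with (ufst n, usnd n) by (symmetry; apply surjective_pairing).
    destruct i as [|i]; cbn [nth]; [reflexivity|].
    rewrite nnth_S. apply IH. apply (ntl_le (S n) f). lia.
Qed.
Lemma dec_list_nth n i : nth i (dec_list n) 0 = nnth n i.
Proof. now apply dec_list_fuel_nth. Qed.

Lemma dec_list_fuel_length f n : length (dec_list_fuel f n) <= f.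
Proof.
  revert n. induction f as [|f IH]; intros n; cbn; [lia|].
  destruct n; cbn; [lia|]. destruct (of_nat n). cbn. specialize (IH n1). lia.
Qed.
Lemma nnth_ge n i : n <= i -> nnth n i = 0.
Proof.
  intros H. rewrite <- dec_list_nth. apply nth_overflow.
  assert (L := dec_list_fuel_length n n). unfold dec_list. lia.
Qed.

(** A constant sequence [j] names the dense point [alpha_j], so these prefixes are all that is
    needed to query an associate at dense points. *)
Definition enc_const (j k : nat) : nat :=
  nat_rect (fun _ => nat) 0 (fun _ a => S (npair j a)) k.
#[local] Instance enc_const_code : code2 enc_const.
Proof. eexists; intros p x y. unfold enc_const. ev_auto. Qed.
Lemma enc_list_prefix_const j k : enc_list (prefix (fun _ => j) k) = enc_const j k.
Proof.
  unfold prefix. generalize 0. induction k as [|k IH]; intros s; cbn; [reflexivity|].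
  now rewrite IH.
Qed.

Lemma nnth_enc l i : nnth (enc_list l) i = nth i l 0.
Proof.
  revert i. induction l as [|a l IH]; intros i; [rewrite nnth_0l; now destruct i|].
  destruct i; cbn [enc_list nth].
  - unfold nnth, nhd. cbn [ndrop nat_rect Nat.pred]. apply ufst_npair.
  - rewrite nnth_S. rewrite <- IH. f_equal. apply (usnd_npair a).
Qed.
Lemma ndrop_enc l i : ndrop (enc_list l) i = enc_list (skipn i l).
Proof.
  revert i. induction l as [|a l IH]; intros i.
  - rewrite skipn_nil. induction i; [reflexivity|]. now rewrite ndrop_S.
  - destruct i; [reflexivity|]. rewrite ndrop_S. cbn [skipn].
    rewrite <- IH. f_equal. unfold ntl. cbn [enc_list Nat.pred].
    apply (usnd_npair a).
Qed.

Definition ndiv (a b : nat) : nat := least (fun z => S a - S z * b).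
Lemma ndiv_spec a b : 0 < b -> ndiv a b * b <= a < S (ndiv a b) * b.
Proof.
  intros Hb. destruct (least_spec (fun z => S a - S z * b)) as [H0 H1]; [exists a; nia|].
  fold (ndiv a b) in H0, H1. cbv beta in H0. split; [|lia].
  destruct (ndiv a b) as [|m]; [lia|]. specialize (H1 m ltac:(lia)). cbv beta in H1. lia.
Qed.

(* [comp_fun3] only runs codes on the zero oracle. *)
Fixpoint deorc (c : code) : code :=
  match c with
  | cOrc => cZero
  | cComp f gs => cComp (deorc f) (map deorc gs)
  | cPrec f g => cPrec (deorc f) (deorc g)
  | cMu f => cMu (deorc f)
  | _ => c
  end.

(** Structural recursion on the derivations themselves also reaches those that [evMu] keeps under an
    existential. *)
Lemma ev_deorc p c xs v : ev (fun _ => 0) c xs v -> ev p (deorc c) xs v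
with evs_deorc p gs xs ys : evs (fun _ => 0) gs xs ys -> evs p (map deorc gs) xs ys.
Proof.
  - intros H.
    destruct H as
      [| | | |f gs xs ys v Hgs Hf|f g xs v Hf|f g n xs a v H1 H2|f xs k H0 H1]; cbn [deorc].
    + constructor.
    + constructor.
    + constructor.
    + constructor.
    + econstructor; [exact (evs_deorc p _ _ _ Hgs)|exact (ev_deorc p _ _ _ Hf)].
    + constructor. exact (ev_deorc p _ _ _ Hf).
    + econstructor; [exact (ev_deorc p _ _ _ H1)|exact (ev_deorc p _ _ _ H2)].
    + constructor; [exact (ev_deorc p _ _ _ H0)|].
      intros j Hj. destruct (H1 j Hj) as [w Hw]. exists w. exact (ev_deorc p _ _ _ Hw).
  - intros H. destruct H as [|g gs xs v vs Hg Hgs]; cbn [map].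
    + constructor.
    + constructor; [exact (ev_deorc p _ _ _ Hg)|exact (evs_deorc p _ _ _ Hgs)].
Qed.

(** * Computable Banach spaces *)

Local Open Scope R_scope.

#[local] Arguments cb_add {_}.
#[local] Arguments cb_zero {_}.
#[local] Arguments cb_opp {_}.
#[local] Arguments cb_scal {_}.
#[local] Arguments cb_norm {_}.

(** * Vector identities by reflection on the coefficients of the atoms *)

Inductive vexp : Type :=
| vVar : nat -> vexp
| vZero : vexp
| vAdd : vexp -> vexp -> vexp
| vOpp : vexp -> vexp
| vScal : R -> vexp -> vexp.

Fixpoint vden {X : CompBanach} (env : list X) (e : vexp) : X :=
  match e with
  | vVar i => nth i env cb_zero
  | vZero => cb_zero
  | vAdd a b => cb_add (vden env a) (vden env b)
  | vOpp a => cb_opp (vden env a)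
  | vScal r a => cb_scal r (vden env a)
  end.

Fixpoint vcoef (e : vexp) (i : nat) : R :=
  match e with
  | vVar j => if Nat.eqb i j then 1 else 0
  | vZero => 0
  | vAdd a b => vcoef a i + vcoef b i
  | vOpp a => - vcoef a i
  | vScal r a => r * vcoef a i
  end.

Fixpoint vcomb {X : CompBanach} (c : nat -> R) (env : list X) : X :=
  match env with
  | [] => cb_zero
  | x :: env' => cb_add (cb_scal (c O) x) (vcomb (fun i => c (S i)) env')
  end.

Section Vec.
Context {X : CompBanach}.
Implicit Types (x y z : X) (env : list X).

Lemma v0add x : cb_add cb_zero x = x.
Proof. now rewrite cb_addC, cb_add0. Qed.
Lemma vcancel x y z : cb_add x y = cb_add x z -> y = z.
Proof.
  intros H. rewrite <- (v0add y), <- (v0add z), <- (cb_addN _ x), (cb_addC _ x).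
  now rewrite <- !cb_addA, H.
Qed.
Lemma vscal0l x : cb_scal 0 x = cb_zero.
Proof.
  apply (vcancel (cb_scal 0 x)). rewrite <- cb_scalDl, cb_add0. f_equal. ring.
Qed.
Lemma vscal0r r : cb_scal r (cb_zero : X) = cb_zero.
Proof. rewrite <- (vscal0l cb_zero), cb_scalA. f_equal. ring. Qed.
Lemma voppE x : cb_opp x = cb_scal (-1) x.
Proof.
  apply (vcancel x). rewrite cb_addN. rewrite <- (cb_scal1 _ x) at 1.
  rewrite <- cb_scalDl. replace (1 + -1) with 0 by ring. now rewrite vscal0l.
Qed.
Lemma vaddACA x y z t : cb_add (cb_add x y) (cb_add z t) = cb_add (cb_add x z) (cb_add y t).
Proof.
  rewrite <- !cb_addA. f_equal. rewrite !cb_addA. f_equal. apply cb_addC.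
Qed.

Lemma vcomb_ext c d env :
  (forall i, (i < length env)%nat -> c i = d i) -> vcomb c env = vcomb d env.
Proof.
  revert c d. induction env as [|x env IH]; intros c d H; cbn; [easy|].
  f_equal; [f_equal; apply H; cbn; lia|]. apply IH. intros i Hi. apply H. cbn. lia.
Qed.
Lemma vcomb_zero env : vcomb (fun _ => 0) env = cb_zero.
Proof. induction env as [|x env IH]; cbn; [easy|]. now rewrite IH, vscal0l, cb_add0. Qed.
Lemma vcomb_add c d env :
  vcomb (fun i => c i + d i) env = cb_add (vcomb c env) (vcomb d env).
Proof.
  revert c d. induction env as [|x env IH]; intros c d; cbn; [now rewrite cb_add0|].
  rewrite IH, cb_scalDl. apply vaddACA.
Qed.
Lemma vcomb_scal r c env : vcomb (fun i => r * c i) env = cb_scal r (vcomb c env).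
Proof.
  revert c. induction env as [|x env IH]; intros c; cbn; [now rewrite vscal0r|].
  now rewrite IH, cb_scalDr, cb_scalA.
Qed.
Lemma vcomb_var env j :
  (vcomb (fun i => if Nat.eqb i j then 1 else 0) env) = nth j env cb_zero.
Proof.
  revert j. induction env as [|x env IH]; intros j; cbn; [now destruct j|].
  destruct j as [|j]; cbn.
  - now rewrite vcomb_zero, cb_scal1, cb_add0.
  - now rewrite IH, vscal0l, v0add.
Qed.

Lemma vden_comb env e : vden env e = vcomb (vcoef e) env.
Proof.
  induction e as [i| |a IHa b IHb|a IHa|r a IHa]; cbn.
  - symmetry. apply vcomb_var.
  - symmetry. apply vcomb_zero.
  - rewrite IHa, IHb. symmetry. apply vcomb_add.
  - rewrite IHa, voppE, <- vcomb_scal. apply vcomb_ext. intros. ring.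
  - rewrite IHa. symmetry. apply vcomb_scal.
Qed.

(** A bounded quantifier by recursion, which [cbn] unfolds into one real identity per atom. *)
Fixpoint vall (P : nat -> Prop) (n : nat) : Prop :=
  match n with O => True | S m => P m /\ vall P m end.
Lemma vall_spec P n : vall P n -> forall i, (i < n)%nat -> P i.
Proof.
  induction n as [|n IH]; cbn; [lia|]. intros [H0 H] i Hi.
  destruct (Nat.eq_dec i n) as [->|]; [easy|]. apply IH; [easy|lia].
Qed.
Lemma vden_eq env a b :
  vall (fun i => vcoef a i = vcoef b i) (length env) -> vden env a = vden env b.
Proof.
  intros H. rewrite !vden_comb. apply vcomb_ext. now apply vall_spec.
Qed.
End Vec.

Ltac v_index x l :=
  lazymatch l with
  | x :: _ => constr:(O)
  | _ :: ?l' => let i := v_index x l' in constr:(S i)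
  end.
Ltac v_atoms t l :=
  lazymatch t with
  | cb_zero => l
  | cb_add ?a ?b => let l := v_atoms a l in v_atoms b l
  | cb_opp ?a => v_atoms a l
  | cb_scal _ ?a => v_atoms a l
  | ?x => match l with
          | _ => let i := v_index x l in l
          | _ => constr:(x :: l)
          end
  end.
Ltac v_reify t l :=
  lazymatch t with
  | cb_zero => constr:(vZero)
  | cb_add ?a ?b => let a := v_reify a l in let b := v_reify b l in constr:(vAdd a b)
  | cb_opp ?a => let a := v_reify a l in constr:(vOpp a)
  | cb_scal ?r ?a => let a := v_reify a l in constr:(vScal r a)
  | ?x => let i := v_index x l in constr:(vVar i)
  end.
Ltac vec_eq :=
  lazymatch goal with
  | |- @eq (cb_V ?X) ?a ?b =>
      let l := v_atoms a (@nil (cb_V X)) in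
      let l := v_atoms b l in
      let a' := v_reify a l in
      let b' := v_reify b l in
      change (vden l a' = vden l b'); apply vden_eq;
      cbn [vall length vcoef Nat.eqb]; repeat split
  end.
Ltac vec := vec_eq; try ring; try (field; try lra).

Definition vsub {X : CompBanach} (x y : X) : X := cb_add x (cb_opp y).

Section Norm.
Context {X : CompBanach}.
Implicit Types (x y z : X).

Lemma norm_zero : cb_norm (cb_zero : X) = 0.
Proof. now apply cb_norm0. Qed.
Lemma norm_opp x : cb_norm (cb_opp x) = cb_norm x.
Proof. rewrite voppE, cb_normZ, (Rabs_left (-1)) by lra. ring. Qed.
Lemma norm_sub_sym x y : cb_norm (vsub x y) = cb_norm (vsub y x).
Proof. rewrite <- norm_opp. f_equal. unfold vsub. vec. Qed.
Lemma norm_ge0 x : 0 <= cb_norm x.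
Proof.
  assert (H := cb_normD X x (cb_opp x)). rewrite cb_addN, norm_zero, norm_opp in H. lra.
Qed.
Lemma norm_tri x y : cb_norm x <= cb_norm y + cb_norm (vsub x y).
Proof.
  replace x with (cb_add y (vsub x y)) at 1 by (unfold vsub; vec). apply cb_normD.
Qed.
Lemma norm_sub_tri x y z : cb_norm (vsub x z) <= cb_norm (vsub x y) + cb_norm (vsub y z).
Proof.
  replace (vsub x z) with (cb_add (vsub x y) (vsub y z)) by (unfold vsub; vec).
  apply cb_normD.
Qed.
Lemma norm_abs_tri x y : Rabs (cb_norm x - cb_norm y) <= cb_norm (vsub x y).
Proof.
  assert (H1 := norm_tri x y). assert (H2 := norm_tri y x).
  rewrite norm_sub_sym in H2. apply Rabs_le. lra.
Qed.
Lemma norm_pos x : x <> cb_zero -> 0 < cb_norm x.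
Proof.
  intros H. destruct (Rle_lt_or_eq_dec _ _ (norm_ge0 x)) as [H0|H0]; [easy|].
  now destruct H; apply cb_norm0.
Qed.
Lemma sub_self x : cb_norm (vsub x x) = 0.
Proof. unfold vsub. rewrite cb_addN. apply norm_zero. Qed.
End Norm.

Lemma Rabs_le_inv x a : Rabs x <= a -> - a <= x <= a.
Proof. unfold Rabs. destruct (Rcase_abs x); lra. Qed.
Lemma half_pow_pos n : 0 < / 2 ^ n.
Proof. apply Rinv_0_lt_compat, pow_lt. lra. Qed.
Lemma half_pow_S n : / 2 ^ S n = / 2 ^ n / 2.
Proof. cbn [pow]. rewrite Rinv_mult. lra. Qed.
Lemma half_pow_add m n : / 2 ^ (m + n) = / 2 ^ m * / 2 ^ n.
Proof. now rewrite pow_add, Rinv_mult. Qed.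
Lemma INR_le_pow2 n : INR n <= 2 ^ n.
Proof.
  induction n as [|n IH]; [cbn; lra|]. rewrite S_INR. cbn [pow].
  assert (1 <= 2 ^ n) by (apply pow_R1_Rle; lra). lra.
Qed.
Lemma half_pow_small eps : 0 < eps -> exists n, / 2 ^ n < eps.
Proof.
  intros He. destruct (INR_unbounded (/ eps)) as [n Hn]. exists n.
  rewrite <- (Rinv_inv eps). apply Rinv_0_lt_contravar; [now apply Rinv_0_lt_compat|].
  assert (H := INR_le_pow2 n). lra.
Qed.
Lemma half_pow_le m n : (m <= n)%nat -> / 2 ^ n <= / 2 ^ m.
Proof.
  intros H. apply Rinv_le_contravar; [apply pow_lt; lra|]. apply Rle_pow; [lra|easy].
Qed.

(** The displacement bound places each closed ball inside the preceding one, and the halving makes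
    the centres Cauchy. Both category arguments, for uniform boundedness and for the smooth point,
    end here. *)
Lemma nested_balls (X : CompBanach) (x : nat -> X) (r : nat -> R) :
  (forall s, 0 < r s) -> (forall s, r (S s) <= r s / 2) ->
  (forall s, cb_norm (vsub (x (S s)) (x s)) <= r s - r (S s)) ->
  exists l, forall s, cb_norm (vsub l (x s)) <= r s.
Proof.
  intros Hpos Hhalf Hin.
  assert (Hd : forall s k, cb_norm (vsub (x (k + s)%nat) (x s)) <= r s - r (k + s)%nat).
  { intros s. induction k as [|k IH]; [rewrite sub_self; cbn; lra|].
    assert (T := norm_sub_tri (x (S k + s)%nat) (x (k + s)%nat) (x s)).
    specialize (Hin (k + s)%nat). change (S k + s)%nat with (S (k + s)) in *. lra. }
  assert (Hle : forall s t, (s <= t)%nat -> cb_norm (vsub (x t) (x s)) <= r s).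
  { intros s t Hst. specialize (Hd s (t - s)%nat). replace (t - s + s)%nat with t in Hd by lia.
    specialize (Hpos t). lra. }
  assert (Hr : forall s, r s <= r O * / 2 ^ s).
  { induction s as [|s IH]; [cbn; lra|]. rewrite half_pow_S. specialize (Hhalf s). lra. }
  assert (Hsmall : forall eps, 0 < eps -> exists N, r N < eps).
  { intros eps He. destruct (half_pow_small (eps / r O)) as [N HN].
    { now apply Rdiv_lt_0_compat. }
    exists N. specialize (Hr N). apply (Rmult_lt_compat_l (r O)) in HN; [|easy].
    specialize (Hpos O). replace (r O * (eps / r O)) with eps in HN by (field; lra). lra. }
  destruct (cb_complete X x) as [l Hl].
  { intros eps He. destruct (Hsmall (eps / 2) ltac:(lra)) as [N HN]. exists N.
    intros m n Hm Hn. fold (vsub (x m) (x n)).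
    assert (T := norm_sub_tri (x m) (x N) (x n)). rewrite (norm_sub_sym (x N)) in T.
    assert (A := Hle N m Hm). assert (B := Hle N n Hn). lra. }
  exists l. intros s. apply le_epsilon. intros eps He.
  destruct (Hl eps He) as [N HN]. specialize (HN (N + s)%nat ltac:(lia)).
  fold (vsub (x (N + s)%nat) l) in HN. rewrite norm_sub_sym in HN.
  assert (T := norm_sub_tri l (x (N + s)%nat) (x s)).
  assert (A := Hle s (N + s)%nat ltac:(lia)). lra.
Qed.

(** * The uniform boundedness theorem *)

Lemma is_bounded_pos (X Y : CompBanach) (T : X -> Y) :
  is_bounded X Y T -> exists c, 0 < c /\ forall x, cb_norm (T x) <= c * cb_norm x.
Proof.
  intros [c Hc]. exists (Rabs c + 1). split; [assert (H := Rabs_pos c); lra|].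
  intros x. assert (H := Hc x). assert (H1 := Rle_abs c). assert (H2 := norm_ge0 x). nra.
Qed.

Lemma linear_sub (X Y : CompBanach) (T : X -> Y) :
  is_linear X Y T -> forall x y, T (vsub x y) = vsub (T x) (T y).
Proof. intros [Ha Hs] x y. unfold vsub. now rewrite Ha, !voppE, Hs. Qed.

(** Without a common bound, every ball contains a smaller one on all of which some [T i] has norm at
    least [n]; a point common to such balls for every [n] has an unbounded orbit. *)
Lemma uniform_boundedness (X Y : CompBanach) (T : nat -> X -> Y) :
  (forall i, is_linear X Y (T i) /\ is_bounded X Y (T i)) ->
  (forall x, exists b, forall i, cb_norm (T i x) <= b) ->
  exists M : nat, forall i x, cb_norm x <= 1 -> cb_norm (T i x) <= INR M.
Proof.
  intros HT Hpt. apply NNPP. intros Hno.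
  (* Positivity of the radius is assumed under the existential, so that choice gives a total step
     function that can be iterated. *)
  assert (Hstep : forall (n : nat) (s : X * R), exists s' : X * R, 0 < snd s ->
    0 < snd s' <= snd s / 2 /\ cb_norm (vsub (fst s') (fst s)) <= snd s - snd s' /\
    exists i, forall v, cb_norm (vsub v (fst s')) <= snd s' -> INR n <= cb_norm (T i v)).
  { intros n [x r]. cbn [fst snd].
    destruct (classic (0 < r)) as [Hr|Hr]; [|now exists (x, r)].
    destruct (INR_unbounded (2 * (INR n + 1) / r)) as [M HM].
    assert (Hx : exists i xi, cb_norm xi <= 1 /\ INR M < cb_norm (T i xi)).
    { apply NNPP. intros H. apply Hno. exists M. intros i xi Hxi.
      apply Rnot_lt_le. intros Hlt. apply H. now exists i, xi. }
    destruct Hx as (i & xi & Hxi & Hbig).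
    destruct (HT i) as [Hlin Hb]. destruct (is_bounded_pos _ _ _ Hb) as (c & Hc & Hbd).
    assert (Hw : exists w : X, cb_norm (vsub w x) <= r / 2 /\ INR n + 1 <= cb_norm (T i w)).
    (* The two points differ by [r] times [xi], so their images cannot both be short. *)
    { set (a := cb_add x (cb_scal (r / 2) xi)). set (b := vsub x (cb_scal (r / 2) xi)).
      assert (Hn : cb_norm (cb_scal (r / 2) xi) <= r / 2).
      { rewrite cb_normZ, Rabs_pos_eq by lra. nra. }
      assert (Hab : r * INR M <= cb_norm (T i a) + cb_norm (T i b)).
      { assert (E : T i (vsub a b) = cb_scal r (T i xi)).
        { destruct Hlin as [_ Hs]. rewrite <- Hs. f_equal. unfold a, b, vsub. vec. }
        rewrite linear_sub in E by easy.
        assert (N := cb_normD Y (T i a) (cb_opp (T i b))).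
        fold (vsub (T i a) (T i b)) in N. rewrite E, norm_opp, cb_normZ in N.
        rewrite Rabs_pos_eq in N by lra. nra. }
      assert (2 * (INR n + 1) < r * INR M).
      { apply (Rmult_lt_compat_l r) in HM; [|easy].
        replace (r * (2 * (INR n + 1) / r)) with (2 * (INR n + 1)) in HM by (field; lra).
        lra. }
      destruct (Rle_lt_dec (INR n + 1) (cb_norm (T i a))) as [H1|H1].
      - exists a. split; [|easy].
        replace (vsub a x) with (cb_scal (r / 2) xi) by (unfold a, vsub; vec). easy.
      - exists b. split; [|lra]. rewrite norm_sub_sym.
        replace (vsub x b) with (cb_scal (r / 2) xi) by (unfold b, vsub; vec). easy. }
    (* Within distance [/ c] of [w] the image moves by at most 1, which uses up the margin in
       [INR n + 1]. *)
    destruct Hw as (w & Hw1 & Hw2). exists (w, Rmin (r / 2) (/ c)). intros _. cbn [fst snd].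
    assert (Hc' : 0 < / c) by now apply Rinv_0_lt_compat.
    assert (M1 := Rmin_l (r / 2) (/ c)). assert (M2 := Rmin_r (r / 2) (/ c)).
    assert (M3 : 0 < Rmin (r / 2) (/ c)) by (apply Rmin_glb_lt; lra).
    repeat split; [lra|lra|lra|]. exists i. intros v Hv.
    assert (N := norm_tri (T i w) (T i v)). rewrite norm_sub_sym, <- linear_sub in N by easy.
    assert (B := Hbd (vsub v w)).
    assert (c * cb_norm (vsub v w) <= c * / c) by (apply Rmult_le_compat_l; lra).
    rewrite Rinv_r in H by lra. lra. }
  assert (Hch := fun n s => constructive_indefinite_description _ (Hstep n s)).
  pose (st := nat_rect (fun _ => (X * R)%type) (cb_zero, 1) (fun n s => proj1_sig (Hch n s))).
  assert (Hpos : forall s, 0 < snd (st s)).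
  { induction s as [|s IH]; [cbn; lra|]. exact (proj1 (proj1 (proj2_sig (Hch s (st s)) IH))). }
  assert (Hst := fun s => proj2_sig (Hch s (st s)) (Hpos s)).
  change (forall s, 0 < snd (st (S s)) <= snd (st s) / 2 /\
    cb_norm (vsub (fst (st (S s))) (fst (st s))) <= snd (st s) - snd (st (S s)) /\
    exists i, forall v, cb_norm (vsub v (fst (st (S s)))) <= snd (st (S s)) ->
      INR s <= cb_norm (T i v)) in Hst.
  destruct (nested_balls X (fun s => fst (st s)) (fun s => snd (st s))) as [l Hl];
    [exact Hpos|apply Hst|apply Hst|].
  destruct (Hpt l) as [b Hb]. destruct (INR_unbounded b) as [n Hn].
  destruct (Hst n) as (_ & _ & i & Hi). specialize (Hi l (Hl (S n))). specialize (Hb i). lra.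
Qed.

(** * The dense sequence *)

Lemma nnth_build_ge g L l : (L <= l)%nat -> nnth (build g L) l = 0%nat.
Proof.
  intros Hl. replace l with (L + (l - L))%nat by lia. generalize (l - L)%nat. clear l Hl.
  unfold build. set (step := fun k a => _). intros d.
  assert (H : forall k, nnth (nat_rect (fun _ => nat) 0%nat step k) (k + d)%nat = 0%nat).
  { induction k as [|k IH]; [apply nnth_0l|]. cbn [nat_rect]. unfold step at 1.
    cbn [Nat.add]. rewrite nnth_S. unfold ntl. cbn [Nat.pred]. now rewrite usnd_npair. }
  apply H.
Qed.

Lemma qval_0 : qval 0 = 0.
Proof. rewrite qval_frac. cbn. lra. Qed.

Lemma qval_dense r eps : 0 < eps -> exists q, Rabs (qval q - r) < eps.
Proof.
  intros He. destruct (INR_unbounded (/ eps)) as [n Hn].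
  assert (Hi : 0 < / eps) by now apply Rinv_0_lt_compat.
  assert (H0 : 0 < INR n) by lra.
  destruct (archimed (r * INR n)) as [A1 A2]. set (z := up (r * INR n)) in *.
  exists (qmk (Z.to_nat z) (Z.to_nat (- z)) n).
  rewrite qval_qmk by now apply INR_lt.
  replace (INR (Z.to_nat z) - INR (Z.to_nat (- z))) with (IZR z).
  2: { rewrite !INR_IZR_INZ, <- minus_IZR. f_equal. lia. }
  assert (Hinv : / INR n < eps).
  { rewrite <- (Rinv_inv eps). apply Rinv_0_lt_contravar; lra. }
  replace (IZR z / INR n - r) with ((IZR z - r * INR n) * / INR n) by (field; lra).
  assert (0 < / INR n) by now apply Rinv_0_lt_compat.
  rewrite Rabs_pos_eq by nra. nra.
Qed.

Section Alpha.
Context {X : CompBanach}.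

Definition linc (c : nat -> R) (L : nat) : X :=
  fold_right cb_add cb_zero (map (fun i => cb_scal (c i) (cb_e X i)) (seq 0 L)).

Lemma linc_S c L : linc c (S L) = cb_add (linc c L) (cb_scal (c L) (cb_e X L)).
Proof.
  unfold linc. rewrite seq_S, map_app. cbn [map Nat.add].
  induction (map _ (seq 0 L)) as [|y l IH]; cbn [app fold_right].
  - vec.
  - rewrite IH. vec.
Qed.

Lemma linc_ext c d L : (forall l, (l < L)%nat -> c l = d l) -> linc c L = linc d L.
Proof.
  intros H. unfold linc. f_equal. apply map_ext_in. intros l Hl%in_seq. f_equal. apply H. lia.
Qed.

Lemma linc_pad c L L' :
  (L <= L')%nat -> (forall l, (L <= l)%nat -> c l = 0) -> linc c L' = linc c L.
Proof.
  intros HL Hc. induction HL as [|L' HL IH]; [easy|].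
  rewrite linc_S, Hc, IH by easy. vec.
Qed.

Lemma linc_add c d r L :
  linc (fun l => c l + r * d l) L = cb_add (linc c L) (cb_scal r (linc d L)).
Proof.
  induction L as [|L IH]; [unfold linc; cbn; vec|].
  rewrite !linc_S, IH. vec.
Qed.

(** The code bounds the length of its list, so several dense points can be written as sums of one
    common length. *)
Lemma cb_alpha_linc n L :
  (n <= L)%nat -> cb_alpha X n = linc (fun l => qval (nnth n l)) L.
Proof.
  intros HL. rewrite (linc_pad _ n) by (easy || intros l Hl; rewrite nnth_ge, qval_0; easy).
  rewrite (linc_pad _ (length (dec_list n)) n).
  2: apply dec_list_fuel_length.
  2: { intros l Hl. rewrite <- dec_list_nth, nth_overflow by easy. apply qval_0. }
  unfold cb_alpha, linc. f_equal.
  rewrite (map_ext _ (fun i => cb_scal (qval (nth (i - 0) (dec_list n) 0%nat)) (cb_e X i))).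
  2: { intros i. now rewrite Nat.sub_0_r, dec_list_nth. }
  generalize 0%nat at 1 2 4. generalize (dec_list n) as l.
  induction l as [|a l IH]; intros s; cbn [combine length seq map]; [easy|].
  rewrite Nat.sub_diag. cbn [nth]. f_equal. rewrite IH. apply map_ext_in.
  intros i Hi%in_seq. now replace (i - s)%nat with (S (i - S s)) by lia.
Qed.

Lemma alpha_0 : cb_alpha X 0 = cb_zero.
Proof. reflexivity. Qed.

Lemma alpha_lc i q j :
  cb_alpha X (lc i q j) = cb_add (cb_alpha X i) (cb_scal (qval q) (cb_alpha X j)).
Proof.
  set (L := (lc i q j + (i + j))%nat).
  rewrite (cb_alpha_linc i L), (cb_alpha_linc j L), (cb_alpha_linc _ L), <- linc_add by lia.
  apply linc_ext. intros l _. unfold lc.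
  destruct (Nat.lt_ge_cases l (i + j)) as [H|H].
  - rewrite nnth_build by easy. apply qval_qlin.
  - rewrite nnth_build_ge, !nnth_ge, qval_0 by lia. ring.
Qed.

Lemma alpha_basis m : exists j, cb_alpha X j = cb_e X m.
Proof.
  exists (enc_list (repeat 0%nat m ++ [qmk 1 0 1])).
  set (n := enc_list _). rewrite (cb_alpha_linc n (n + S m)) by lia.
  rewrite (linc_ext _ (fun l => if Nat.eqb l m then 1 else 0)).
  - rewrite (linc_pad _ (S m)); [|lia|].
    + rewrite linc_S, Nat.eqb_refl.
      rewrite (linc_ext _ (fun _ => 0)).
      * assert (E : forall L, linc (fun _ => 0) L = cb_zero).
        { induction L as [|L IH]; [reflexivity|]. rewrite linc_S, IH. vec. }
        rewrite E. vec.
      * intros l Hl. now replace (Nat.eqb l m) with false by (symmetry; apply Nat.eqb_neq; lia).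
    + intros l Hl. now replace (Nat.eqb l m) with false by (symmetry; apply Nat.eqb_neq; lia).
  - intros l _. unfold n. rewrite nnth_enc.
    destruct (Nat.eqb_spec l m) as [->|Hl].
    + rewrite app_nth2; rewrite repeat_length; [|lia]. rewrite Nat.sub_diag. cbn [nth].
      rewrite qval_qmk by lia. cbn. lra.
    + destruct (Nat.lt_ge_cases l m) as [H|H].
      * rewrite app_nth1 by now rewrite repeat_length. rewrite nth_repeat. apply qval_0.
      * rewrite nth_overflow; [apply qval_0|]. rewrite length_app, repeat_length. cbn. lia.
Qed.

(** The space only provides density of real combinations; their coefficients are replaced by
    rationals one term at a time. *)
Lemma alpha_dense (x : X) eps : 0 < eps -> exists j, cb_norm (vsub (cb_alpha X j) x) < eps.
Proof.
  revert eps. pose (cl := fun y : X => forall eps, 0 < eps ->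
    exists j, cb_norm (vsub (cb_alpha X j) y) < eps).
  assert (Hspan : forall c L, cl (linc c L)).
  { intros c. induction L as [|L IH]; intros eps He.
    - exists 0%nat. unfold linc. cbn [seq map fold_right]. now rewrite alpha_0, sub_self.
    - rewrite linc_S. destruct (IH (eps / 2) ltac:(lra)) as [j Hj].
      destruct (alpha_basis L) as [b Hb].
      assert (Hn := norm_ge0 (cb_e X L)).
      (* The added 1 covers a basis vector equal to zero. *)
      destruct (qval_dense (c L) (eps / 2 / (cb_norm (cb_e X L) + 1))) as [q Hq].
      { apply Rdiv_lt_0_compat; lra. }
      exists (lc j q b). rewrite alpha_lc, Hb.
      set (a := cb_alpha X j) in *. set (e := cb_e X L) in *.
      replace (vsub (cb_add a (cb_scal (qval q) e)) (cb_add (linc c L) (cb_scal (c L) e)))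
        with (cb_add (vsub a (linc c L)) (cb_scal (qval q - c L) e)) by (unfold vsub; vec).
      eapply Rle_lt_trans; [apply cb_normD|]. rewrite cb_normZ.
      apply (Rmult_lt_compat_r (cb_norm e + 1)) in Hq; [|lra].
      replace (eps / 2 / (cb_norm e + 1) * (cb_norm e + 1)) with (eps / 2) in Hq by (field; lra).
      assert (H := Rabs_pos (qval q - c L)). nra. }
  intros eps He. destruct (cb_span_dense X x (eps / 2) ltac:(lra)) as (k & c & Hk).
  destruct (Hspan c k (eps / 2) ltac:(lra)) as [j Hj]. exists j.
  assert (T := norm_sub_tri (cb_alpha X j) (linc c k) x).
  change (cb_norm (vsub (linc c k) x) < eps / 2) in Hk. lra.
Qed.

End Alpha.

#[local] Instance ndiv_code : code2 (fun a b => ndiv a (S b)).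
Proof. eexists; intros p x y. unfold ndiv. ev_auto. exists x. nia. Qed.

Lemma zposneg a : zpos a = 0%nat \/ zneg a = 0%nat.
Proof. unfold zpos, zneg, evenb. destruct (Nat.even a); lia. Qed.

(** Scaled integer approximations turn all later tests into comparisons in [nat]. The error 2 is 1
    from [cb_dist_comp], applied to the distance from [alpha_0], which is zero, plus 1 from rounding
    down. *)
Lemma norm_approx (X : CompBanach) :
  { N : nat -> nat -> nat & code2 N &
    forall i k, Rabs (INR (N i k) - 2 ^ k * cb_norm (cb_alpha X i)) <= 2 }.
Proof.
  destruct (constructive_indefinite_description _ (cb_dist_comp X)) as [f [Hc Hf]].
  apply constructive_indefinite_description in Hc. destruct Hc as [c Hc].
  assert (fc : code3 f) by (exists (deorc c); intros; apply ev_deorc, Hc).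
  exists (fun i k => ndiv (zpos (ufst (f i 0%nat k)) * 2 ^ k) (S (usnd (f i 0%nat k)))).
  - eexists; intros p x y.
    eapply (ev_comp2 _ _ _ _ _ _ _ _ (proj2_sig ndiv_code _)); ev_auto.
  - intros i k. specialize (Hf i 0%nat k). cbv zeta in Hf.
    fold (cb_alpha X i) in Hf. fold (cb_alpha X 0) in Hf. rewrite alpha_0 in Hf.
    replace (cb_add (cb_alpha X i) (cb_opp cb_zero)) with (cb_alpha X i) in Hf by vec.
    fold (qval (f i 0%nat k)) in Hf. rewrite qval_frac in Hf.
    set (q := f i 0%nat k) in *.
    assert (Hz := zposneg (ufst q)).
    assert (Hd := ndiv_spec (zpos (ufst q) * 2 ^ k) (S (usnd q)) ltac:(lia)).
    set (n := ndiv _ _) in *. set (P := zpos (ufst q)) in *. set (M := zneg (ufst q)) in *.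
    set (d := S (usnd q)) in *. set (nu := cb_norm (cb_alpha X i)) in *.
    assert (Hnu : 0 <= nu) by apply norm_ge0.
    assert (H0 : 0 < INR d) by (apply lt_0_INR; unfold d; lia).
    assert (Hk : 0 < 2 ^ k) by (apply pow_lt; lra).
    destruct Hd as [D1 D2]. apply le_INR in D1. apply lt_INR in D2.
    rewrite !mult_INR, pow_INR in D1, D2. rewrite (S_INR n) in D2.
    change (INR 2) with 2 in D1, D2.
    assert (HP : 0 <= INR P) by apply pos_INR. assert (HM : 0 <= INR M) by apply pos_INR.
    assert (E : Rabs (INR P / INR d - nu) <= / 2 ^ k).
    (* An approximation that is not positive is replaced by 0, which is at least as close to the
       norm. *)
    { destruct Hz as [Hz|Hz]; rewrite Hz in *; [|now rewrite Rminus_0_r in Hf].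
      assert (0 <= INR M / INR d) by (apply Rle_mult_inv_pos; lra).
      replace ((INR 0 - INR M) / INR d) with (- (INR M / INR d)) in Hf
        by (change (INR 0) with 0; unfold Rdiv; ring).
      replace (INR 0 / INR d) with 0 by (change (INR 0) with 0; unfold Rdiv; ring).
      rewrite Rabs_minus_sym, Rabs_pos_eq by lra.
      rewrite Rabs_minus_sym, Rabs_pos_eq in Hf by lra. lra. }
    apply (Rmult_le_compat_l (2 ^ k)) in E; [|lra]. rewrite Rinv_r in E by lra.
    rewrite <- (Rabs_pos_eq (2 ^ k)) in E at 1 by lra. rewrite <- Rabs_mult in E.
    set (w := INR P / INR d) in *.
    assert (Hw : INR P = w * INR d) by (unfold w; field; lra). rewrite Hw in D1, D2.
    assert (D1' : INR n <= w * 2 ^ k) by (apply (Rmult_le_reg_r (INR d)); lra).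
    assert (D2' : w * 2 ^ k < INR n + 1) by (apply (Rmult_lt_reg_r (INR d)); lra).
    apply Rabs_le. apply Rabs_le_inv in E. lra.
Qed.

(** * Reducing uniform boundedness to closed choice *)

Definition assoc_at (p : Baire) (i j m k : nat) : nat :=
  p (npair i (npair m (enc_const j k))).

(* [m]-th term of the output of the [i]-th associate in [p] on the constant input [j]. *)
Definition assoc_val (p : Baire) (i j m : nat) : nat :=
  Nat.pred (assoc_at p i j m (least (fun k => 1 - assoc_at p i j m k)%nat)).

(** This is what makes every search in [assoc_val] halt. Names of operator sequences have the
    property, by [delta_fun_assoc]. *)
Definition assoc_total (p : Baire) : Prop :=
  forall i j m, exists k, assoc_at p i j m k <> 0%nat.

Lemma delta_Cauchy_const (X : CompBanach) j : delta_Cauchy X (fun _ => j) (cb_alpha X j).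
Proof.
  intros n. unfold cb_dist. fold (vsub (cb_alpha X j) (cb_alpha X j)).
  rewrite sub_self. left. apply half_pow_pos.
Qed.

Lemma eta_val_const p i j m v :
  eta_val (bproj p i) (fun _ => j) m v ->
  (exists k, assoc_at p i j m k <> 0%nat) /\ assoc_val p i j m = v.
Proof.
  intros (k & Hk & Hlt). unfold bproj in Hk, Hlt.
  rewrite enc_list_prefix_const in Hk. fold (assoc_at p i j m k) in Hk.
  split; [exists k; lia|]. unfold assoc_val.
  destruct (least_spec (fun k => 1 - assoc_at p i j m k)%nat) as [H0 H1]; [exists k; lia|].
  set (l := least _) in *. cbv beta in H0.
  destruct (Nat.lt_trichotomy l k) as [H|[->|H]].
  - specialize (Hlt l H). rewrite enc_list_prefix_const in Hlt.
    fold (assoc_at p i j m l) in Hlt. lia.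
  - now rewrite Hk.
  - specialize (H1 k H). cbv beta in H1. lia.
Qed.

Lemma delta_fun_assoc (X Y : CompBanach) (T : X -> Y) p i j m :
  delta_fun X Y (bproj p i) T ->
  (exists k, assoc_at p i j m k <> 0%nat) /\
  cb_norm (vsub (cb_alpha Y (assoc_val p i j m)) (T (cb_alpha X j))) <= / 2 ^ m.
Proof.
  intros HT. destruct (HT _ _ (delta_Cauchy_const X j)) as (r & Hr & Hd).
  destruct (eta_val_const _ _ _ _ _ (Hr m)) as [H1 H2]. split; [easy|].
  rewrite H2. apply Hd.
Qed.

(* Outputs [S M] when [n] codes [M, i, j, m] such that precision [m] suffices to see
   [|alpha_j| < 1] and [|T_i alpha_j| > M]. *)
Definition refute (NX NY : nat -> nat -> nat) (p : Baire) (n : nat) : nat :=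
  let M := ufst n in
  let i := ufst (usnd n) in
  let j := ufst (usnd (usnd n)) in
  let m := usnd (usnd (usnd n)) in
  (S M * (1 - ((NX j m + 3 - 2 ^ m) + (M * 2 ^ m + 4 - NY (assoc_val p i j m) m))))%nat.

Lemma refute_code (NX NY : nat -> nat -> nat) : code2 NX -> code2 NY ->
  {c | forall p, assoc_total p -> forall n, ev p c [n] (refute NX NY p n)}.
Proof.
  intros HX HY. eexists; intros p Hp n. unfold refute, assoc_val, assoc_at. cbv zeta.
  ev_auto.
  destruct (Hp (ufst (usnd n)) (ufst (usnd (usnd n))) (usnd (usnd (usnd n)))) as [k Hk].
  exists k. unfold assoc_at in Hk. lia.
Qed.

Lemma pow2_INR m : INR (2 ^ m) = 2 ^ m.
Proof. now rewrite pow_INR. Qed.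

Section Refute.
Context {X Y : CompBanach} (NX NY : nat -> nat -> nat).
Hypothesis HNX : forall i k, Rabs (INR (NX i k) - 2 ^ k * cb_norm (cb_alpha X i)) <= 2.
Hypothesis HNY : forall i k, Rabs (INR (NY i k) - 2 ^ k * cb_norm (cb_alpha Y i)) <= 2.

(** At scale [2 ^ m] the norm in [X] is off by at most 2, within the margin 3. In [Y] the norm is
    off by 2 and the output term by 1 more, within the margin 4, so the inequality stays strict. *)
Lemma refute_sound p (T : nat -> X -> Y) n M :
  (forall i, delta_fun X Y (bproj p i) (T i)) -> refute NX NY p n = S M ->
  exists i x, cb_norm x <= 1 /\ INR M < cb_norm (T i x).
Proof.
  intros HT. unfold refute. cbv zeta.
  set (i := ufst (usnd n)). set (j := ufst (usnd (usnd n))).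
  set (m := usnd (usnd (usnd n))). set (t := assoc_val p i j m). intros Hr.
  assert (HM : ufst n = M) by nia. rewrite HM in Hr.
  assert (HA : (NX j m + 3 <= 2 ^ m)%nat) by nia.
  assert (HB : (M * 2 ^ m + 4 <= NY t m)%nat) by nia.
  apply le_INR in HA, HB.
  rewrite plus_INR, pow2_INR in HA. rewrite plus_INR, mult_INR, pow2_INR in HB.
  change (INR 3) with (1 + 1 + 1) in HA. change (INR 4) with (1 + 1 + 1 + 1) in HB.
  exists i, (cb_alpha X j). destruct (delta_fun_assoc X Y (T i) p i j m (HT i)) as [_ Ht].
  fold t in Ht. assert (X1 := Rabs_le_inv _ _ (HNX j m)). assert (Y1 := Rabs_le_inv _ _ (HNY t m)).
  assert (Hm : 0 < 2 ^ m) by (apply pow_lt; lra).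
  assert (Tr := norm_tri (cb_alpha Y t) (T i (cb_alpha X j))).
  apply (Rmult_le_compat_l (2 ^ m)) in Ht; [|lra]. rewrite Rinv_r in Ht by lra.
  split; apply (Rmult_le_reg_l (2 ^ m)) || apply (Rmult_lt_reg_l (2 ^ m)); nra.
Qed.

(** The witness is shrunk to [(1 - e) x] to make room inside the unit ball and then replaced by a
    dense point within [e / 2]. The choice of [e] limits the loss in the image to [d / 3] for
    shrinking and [d / 6] for approximating, so half of the excess [d] remains. *)
Lemma refute_complete p (T : nat -> X -> Y) M i x :
  (forall i, delta_fun X Y (bproj p i) (T i)) ->
  is_linear X Y (T i) -> is_bounded X Y (T i) ->
  cb_norm x <= 1 -> INR M < cb_norm (T i x) ->
  exists n, refute NX NY p n = S M.
Proof.
  intros HT Hlin Hbd Hx Hbig. destruct (is_bounded_pos _ _ _ Hbd) as (c & Hc & Hcx).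
  set (d := cb_norm (T i x) - INR M). assert (Hd : 0 < d) by (unfold d; lra).
  set (e := Rmin (/ 2) (d / (3 * c))).
  assert (He1 : e <= / 2) by apply Rmin_l. assert (He2 : e <= d / (3 * c)) by apply Rmin_r.
  assert (He0 : 0 < e) by (apply Rmin_glb_lt; [lra|]; apply Rdiv_lt_0_compat; lra).
  assert (He3 : e * c <= d / 3).
  { apply (Rmult_le_compat_r c) in He2; [|lra].
    now replace (d / (3 * c) * c) with (d / 3) in He2 by (field; lra). }
  destruct (alpha_dense (cb_scal (1 - e) x) (e / 2) ltac:(lra)) as [j Hj].
  (* The factor 8 makes both margins exceed 8 at scale [2 ^ m], more than the approximation errors
     and the slack of the test together. *)
  destruct (half_pow_small (Rmin (e / 2) (d / 2) / 8)) as [m Hm].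
  { apply Rdiv_lt_0_compat; [|lra]. apply Rmin_glb_lt; lra. }
  assert (M1 := Rmin_l (e / 2) (d / 2)). assert (M2 := Rmin_r (e / 2) (d / 2)).
  assert (Hpm : 0 < 2 ^ m) by (apply pow_lt; lra).
  assert (H1m : 8 < 2 ^ m * (e / 2) /\ 8 < 2 ^ m * (d / 2)).
  { assert (8 < 2 ^ m * Rmin (e / 2) (d / 2)).
    { apply (Rmult_lt_compat_l (8 * 2 ^ m)) in Hm; [|lra].
      replace (8 * 2 ^ m * / 2 ^ m) with 8 in Hm by (field; lra). lra. }
    split; nra. }
  set (a := cb_alpha X j) in *. set (t := assoc_val p i j m).
  destruct (delta_fun_assoc X Y (T i) p i j m (HT i)) as [_ Ht]. fold a t in Ht.
  assert (Ha : cb_norm a <= 1 - e / 2).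
  { assert (Tr := norm_tri a (cb_scal (1 - e) x)).
    rewrite cb_normZ, Rabs_pos_eq in Tr by lra. assert (0 <= cb_norm x) by apply norm_ge0. nra. }
  assert (HTa : INR M + d / 2 <= cb_norm (T i a)).
  { assert (Tr := norm_tri (T i (cb_scal (1 - e) x)) (T i a)).
    rewrite norm_sub_sym, <- linear_sub in Tr by easy.
    assert (B := Hcx (vsub a (cb_scal (1 - e) x))).
    replace (T i (cb_scal (1 - e) x)) with (cb_scal (1 - e) (T i x)) in Tr
      by (symmetry; apply Hlin).
    rewrite cb_normZ, Rabs_pos_eq in Tr by lra.
    assert (Bx := Hcx x).
    assert (c * cb_norm (vsub a (cb_scal (1 - e) x)) <= c * (e / 2))
      by (apply Rmult_le_compat_l; lra).
    assert (e * cb_norm (T i x) <= e * c) by (apply Rmult_le_compat_l; nra).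
    assert (cb_norm (T i x) = INR M + d) by (unfold d; lra). lra. }
  exists (npair M (npair i (npair j m))). unfold refute.
  repeat rewrite ?ufst_npair, ?usnd_npair. cbv zeta. fold t.
  assert (X1 := Rabs_le_inv _ _ (HNX j m)). assert (Y1 := Rabs_le_inv _ _ (HNY t m)).
  fold a in X1. assert (Tr := norm_tri (T i a) (cb_alpha Y t)).
  rewrite norm_sub_sym in Tr.
  apply (Rmult_le_compat_l (2 ^ m)) in Ht; [|lra]. rewrite Rinv_r in Ht by lra.
  assert (HA : (NX j m + 3 <= 2 ^ m)%nat).
  { apply INR_le. rewrite plus_INR, pow2_INR. change (INR 3) with (1 + 1 + 1). nra. }
  assert (HB : (M * 2 ^ m + 4 <= NY t m)%nat).
  { apply INR_le. rewrite plus_INR, mult_INR, pow2_INR. change (INR 4) with (1 + 1 + 1 + 1).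
    nra. }
  nia.
Qed.
End Refute.

Lemma UBT_le_CN (X Y : CompBanach) : weihrauch_le (UBT X Y) C_N.
Proof.
  destruct (norm_approx X) as [NX HcX HX]. destruct (norm_approx Y) as [NY HcY HY].
  exists (fun z => Some (fun _ => z 1%nat)).
  (* The undecidable test only cuts down the domain: [computable_pfun] constrains the code on
     defined arguments alone. *)
  exists (fun p => if excluded_middle_informative (assoc_total p)
                   then Some (refute NX NY p) else None).
  split; [|split].
  - assert (E : {c | forall z n, ev z c [n] (z 1%nat)}) by (eexists; intros; ev_auto).
    destruct E as [c Hc]. exists c. intros z q [= <-] n. apply Hc.
  - destruct (refute_code NX NY HcX HcY) as [c Hc]. exists c. intros p q.
    destruct (excluded_middle_informative (assoc_total p)) as [Hp|]; [|easy].
    intros [= <-] n. now apply Hc.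
  - intros G HG p T HT [Hlin Hbd]. cbn in HT.
    destruct (excluded_middle_informative (assoc_total p)) as [Hp|Hp].
    2: { destruct Hp. intros i j m. apply (delta_fun_assoc X Y (T i) p i j m (HT i)). }
    cbn [obind].
    destruct (HG (refute NX NY p)
      (fun M : nat => forall i x, cb_norm x <= 1 -> cb_norm (T i x) <= INR M))
      as (r & Hr & M & HrM & HM).
    + intros M. split.
      * intros H. apply NNPP. intros Hno. apply H. intros i x Hx. apply Rnot_lt_le.
        intros Hlt. apply Hno.
        destruct (refute_complete NX NY HX HY p T M i x) as [n Hn]; try easy; try apply Hlin.
        now exists n.
      * intros [n Hn] H.
        destruct (refute_sound NX NY HX HY p T n M HT Hn) as (i & x & Hx & Hlt).
        specialize (H i x Hx). lra.
    + destruct (uniform_boundedness X Y T Hlin Hbd) as [M HM]. now exists M.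
    + exists (fun _ => r 0%nat). rewrite Hr. split; [reflexivity|].
      exists M. split; [exact HrM|exact HM].
Qed.

(** * The Gateaux derivative of the norm *)

Section Gateaux.
Context {X : CompBanach} (u : X).
Implicit Types (x y : X).

Definition dquot x (t : R) : R := (cb_norm (cb_add u (cb_scal t x)) - cb_norm u) / t.

Lemma dquot_norm x t : 0 < t -> cb_norm (cb_add u (cb_scal t x)) = cb_norm u + t * dquot x t.
Proof. intros Ht. unfold dquot. field. lra. Qed.

Lemma dquot_bound x t : 0 < t -> - cb_norm x <= dquot x t <= cb_norm x.
Proof.
  intros Ht. assert (E := dquot_norm x t Ht).
  assert (T := norm_abs_tri (cb_add u (cb_scal t x)) u).
  replace (vsub (cb_add u (cb_scal t x)) u) with (cb_scal t x) in T by (unfold vsub; vec).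
  rewrite cb_normZ, (Rabs_pos_eq t) in T by lra. apply Rabs_le_inv in T.
  split; apply (Rmult_le_reg_l t); lra.
Qed.

(** Convexity of the norm: [u + s x] divides the segment from [u] to [u + t x] in the ratio given by
    [l = s / t]. *)
Lemma dquot_mono x s t : 0 < s <= t -> dquot x s <= dquot x t.
Proof.
  intros Hst. assert (E1 := dquot_norm x s ltac:(lra)). assert (E2 := dquot_norm x t ltac:(lra)).
  set (l := s / t).
  assert (Hl : 0 <= l <= 1).
  { unfold l. split; [apply Rle_mult_inv_pos; lra|].
    apply (Rmult_le_reg_r t); [lra|]. unfold Rdiv. rewrite Rmult_assoc, Rinv_l; lra. }
  assert (Hs : s = l * t) by (unfold l; field; lra).
  assert (T := cb_normD X (cb_scal (1 - l) u) (cb_scal l (cb_add u (cb_scal t x)))).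
  replace (cb_add (cb_scal (1 - l) u) (cb_scal l (cb_add u (cb_scal t x))))
    with (cb_add u (cb_scal s x)) in T by (rewrite Hs; vec).
  rewrite !cb_normZ, !Rabs_pos_eq in T by lra.
  apply (Rmult_le_reg_l s); [lra|].
  rewrite E1, E2 in T.
  assert (E : s * dquot x t = l * t * dquot x t) by now rewrite Hs at 1. lra.
Qed.

(** By [dquot_mono] the limit for [t] decreasing to 0 is an infimum, obtained from completeness of
    the reals for the negated quotients. *)
Lemma gateaux_ex x : exists d, (forall t, 0 < t -> d <= dquot x t) /\
  forall eps, 0 < eps -> exists t, 0 < t /\ dquot x t < d + eps.
Proof.
  destruct (completeness (fun r => exists t, 0 < t /\ r = - dquot x t)) as [m [Hub Hlub]].
  - exists (cb_norm x). intros r (t & Ht & ->). assert (H := dquot_bound x t Ht). lra.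
  - exists (- dquot x 1), 1. split; [lra|easy].
  - exists (- m). split.
    + intros t Ht. specialize (Hub (- dquot x t) ltac:(now exists t)). lra.
    + intros eps He. apply NNPP. intros Hno. assert (m <= m - eps); [|lra].
      apply Hlub. intros r (t & Ht & ->). apply Rnot_lt_le. intros Hlt. apply Hno.
      exists t. split; [easy|lra].
Qed.

(* The one-sided Gateaux derivative of the norm at [u]. *)
Definition gateaux x : R := proj1_sig (constructive_indefinite_description _ (gateaux_ex x)).

Lemma gateaux_le x t : 0 < t -> gateaux x <= dquot x t.
Proof. apply (proj2_sig (constructive_indefinite_description _ (gateaux_ex x))). Qed.

Lemma gateaux_glb x d : (forall t, 0 < t -> d <= dquot x t) -> d <= gateaux x.
Proof.
  intros Hd. apply le_epsilon. intros eps He.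
  destruct (proj2 (proj2_sig (constructive_indefinite_description _ (gateaux_ex x))) eps He)
    as (t & Ht & Hlt). fold (gateaux x) in Hlt. specialize (Hd t Ht). lra.
Qed.

(** The point [u + (r / 2) (x + y)] is the midpoint of [u + r x] and [u + r y]. Monotonicity allows
    different steps for [x] and [y], so the two infima can be taken in turn. *)
Lemma gateaux_add_le x y : gateaux (cb_add x y) <= gateaux x + gateaux y.
Proof.
  assert (H : forall s t, 0 < s -> 0 < t -> gateaux (cb_add x y) <= dquot x s + dquot y t).
  { intros s t Hs Ht. set (r := Rmin s t).
    assert (Hr : 0 < r) by now apply Rmin_glb_lt.
    assert (M1 := dquot_mono x r s (conj Hr (Rmin_l s t))).
    assert (M2 := dquot_mono y r t (conj Hr (Rmin_r s t))).
    assert (L := gateaux_le (cb_add x y) (r / 2) ltac:(lra)).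
    assert (E := dquot_norm (cb_add x y) (r / 2) ltac:(lra)).
    assert (T := cb_normD X (cb_scal (/ 2) (cb_add u (cb_scal r x)))
                            (cb_scal (/ 2) (cb_add u (cb_scal r y)))).
    replace (cb_add (cb_scal (/ 2) (cb_add u (cb_scal r x)))
                    (cb_scal (/ 2) (cb_add u (cb_scal r y))))
      with (cb_add u (cb_scal (r / 2) (cb_add x y))) in T by vec.
    rewrite !cb_normZ, !Rabs_pos_eq, !dquot_norm in T by lra.
    assert (dquot (cb_add x y) (r / 2) <= dquot x r + dquot y r); [|lra].
    apply (Rmult_le_reg_l (r / 2)); lra. }
  assert (H1 : gateaux (cb_add x y) - gateaux x <= gateaux y); [|lra].
  apply gateaux_glb. intros t Ht.
  assert (H2 : gateaux (cb_add x y) - dquot y t <= gateaux x); [|lra].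
  apply gateaux_glb. intros s Hs. specialize (H s t Hs Ht). lra.
Qed.

Lemma gateaux_0 : gateaux cb_zero = 0.
Proof.
  assert (E : forall t, 0 < t -> dquot cb_zero t = 0).
  { intros t Ht. unfold dquot. rewrite vscal0r, cb_add0. unfold Rminus. rewrite Rplus_opp_r.
    apply Rmult_0_l. }
  apply Rle_antisym.
  - rewrite <- (E 1) by lra. apply gateaux_le. lra.
  - apply gateaux_glb. intros t Ht. rewrite E; lra.
Qed.

Lemma gateaux_le_norm x : gateaux x <= cb_norm x.
Proof.
  assert (H := gateaux_le x 1 ltac:(lra)). assert (B := dquot_bound x 1 ltac:(lra)). lra.
Qed.

Lemma gateaux_lip x y : gateaux x <= gateaux y + cb_norm (vsub x y).
Proof.
  assert (H := gateaux_add_le y (vsub x y)).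
  replace (cb_add y (vsub x y)) with x in H by (unfold vsub; vec).
  assert (B := gateaux_le_norm (vsub x y)). lra.
Qed.

Lemma gateaux_scal_pos a x : 0 < a -> gateaux (cb_scal a x) = a * gateaux x.
Proof.
  assert (H : forall a x, 0 < a -> gateaux (cb_scal a x) <= a * gateaux x).
  { clear a x. intros a x Ha.
    assert (gateaux (cb_scal a x) / a <= gateaux x).
    { apply gateaux_glb. intros t Ht.
      assert (Hta : 0 < t / a) by now apply Rdiv_lt_0_compat.
      assert (L := gateaux_le (cb_scal a x) (t / a) Hta).
      unfold dquot in *. rewrite cb_scalA in L.
      replace (t / a * a) with t in L by (field; lra).
      apply (Rmult_le_reg_l a); [easy|].
      replace (a * (gateaux (cb_scal a x) / a)) with (gateaux (cb_scal a x)) by (field; lra).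
      eapply Rle_trans; [exact L|]. right. field. lra. }
    apply (Rmult_le_compat_l a) in H; [|lra].
    now replace (a * (gateaux (cb_scal a x) / a)) with (gateaux (cb_scal a x)) in H
      by (field; lra). }
  intros Ha. apply Rle_antisym; [now apply H|].
  assert (Hi : 0 < / a) by now apply Rinv_0_lt_compat.
  assert (L := H (/ a) (cb_scal a x) Hi). rewrite cb_scalA, Rinv_l, cb_scal1 in L by lra.
  apply (Rmult_le_compat_l a) in L; [|lra].
  now rewrite <- Rmult_assoc, Rinv_r, Rmult_1_l in L by lra.
Qed.

(** This is what keeps the functional from vanishing. *)
Lemma gateaux_self : gateaux u = cb_norm u.
Proof.
  assert (E : forall t, 0 < t -> dquot u t = cb_norm u).
  { intros t Ht. unfold dquot.
    replace (cb_add u (cb_scal t u)) with (cb_scal (1 + t) u) by vec.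
    rewrite cb_normZ, Rabs_pos_eq by lra. field. lra. }
  apply Rle_antisym.
  - rewrite <- (E 1) by lra. apply gateaux_le. lra.
  - apply gateaux_glb. intros t Ht. rewrite E; lra.
Qed.

(** Up to sign, [dquot (cb_opp x) t] is the left difference quotient, so the second difference
    measures the gap between right and left quotients. *)
Lemma second_diff x t : 0 < t ->
  cb_norm (cb_add u (cb_scal t x)) + cb_norm (cb_add u (cb_scal (- t) x)) - 2 * cb_norm u
  = t * (dquot x t + dquot (cb_opp x) t).
Proof.
  intros Ht. replace (cb_scal (- t) x) with (cb_scal t (cb_opp x)) by vec.
  rewrite !dquot_norm by easy. ring.
Qed.

Section Smooth.
Hypothesis smooth : forall m eps, 0 < eps -> exists t, 0 < t /\
  dquot (cb_alpha X m) t + dquot (cb_opp (cb_alpha X m)) t <= eps.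

(** Smoothness is given only in the dense directions; the Lipschitz bound extends oddness to all of
    them. An odd sublinear map is linear. *)
Lemma gateaux_opp x : gateaux (cb_opp x) = - gateaux x.
Proof.
  assert (L := gateaux_add_le x (cb_opp x)). rewrite cb_addN, gateaux_0 in L.
  assert (gateaux x + gateaux (cb_opp x) <= 0); [|lra].
  apply le_epsilon. intros eps He.
  destruct (alpha_dense x (eps / 4) ltac:(lra)) as [m Hm].
  destruct (smooth m (eps / 4) ltac:(lra)) as (t & Ht & Hd).
  assert (L1 := gateaux_le (cb_alpha X m) t Ht).
  assert (L2 := gateaux_le (cb_opp (cb_alpha X m)) t Ht).
  assert (L3 := gateaux_lip x (cb_alpha X m)).
  assert (L4 := gateaux_lip (cb_opp x) (cb_opp (cb_alpha X m))).
  rewrite norm_sub_sym in L3.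
  replace (vsub (cb_opp x) (cb_opp (cb_alpha X m))) with (vsub (cb_alpha X m) x) in L4
    by (unfold vsub; vec).
  lra.
Qed.

Lemma gateaux_add x y : gateaux (cb_add x y) = gateaux x + gateaux y.
Proof.
  apply Rle_antisym; [apply gateaux_add_le|].
  assert (L := gateaux_add_le (cb_opp x) (cb_opp y)).
  replace (cb_add (cb_opp x) (cb_opp y)) with (cb_opp (cb_add x y)) in L by vec.
  rewrite !gateaux_opp in L. lra.
Qed.

Lemma gateaux_scal a x : gateaux (cb_scal a x) = a * gateaux x.
Proof.
  destruct (Rtotal_order a 0) as [Ha|[->|Ha]].
  - replace (cb_scal a x) with (cb_opp (cb_scal (- a) x)) by vec.
    rewrite gateaux_opp, gateaux_scal_pos by lra. ring.
  - rewrite vscal0l, gateaux_0. ring.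
  - now apply gateaux_scal_pos.
Qed.

Lemma gateaux_abs x : Rabs (gateaux x) <= cb_norm x.
Proof.
  apply Rabs_le. assert (H1 := gateaux_le_norm x). assert (H2 := gateaux_le_norm (cb_opp x)).
  rewrite gateaux_opp, norm_opp in H2. lra.
Qed.
End Smooth.
End Gateaux.

(** * Density of the points of approximate smoothness *)

Lemma sum_second_diff (h : nat -> R) d n :
  (forall i, (i < n)%nat -> d <= h (S (S i)) + h i - 2 * h (S i)) ->
  h 1%nat - h 0%nat + INR n * d <= h (S n) - h n.
Proof.
  induction n as [|n IH]; intros H; [cbn; lra|].
  specialize (IH ltac:(intros; apply H; lia)). specialize (H n ltac:(lia)).
  rewrite S_INR. lra.
Qed.

(* Mazur: along a line the second differences telescope, so they cannot all be large. *)
Lemma smooth_dense (X : CompBanach) (j m n k : nat) : exists i tau : nat,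
  let a := cb_add (cb_alpha X j) (cb_scal (INR i / 2 ^ tau) (cb_alpha X m)) in
  cb_norm (vsub a (cb_alpha X j)) <= / 2 ^ n / 4 /\
  cb_norm (cb_add a (cb_scal (/ 2 ^ tau) (cb_alpha X m))) +
  cb_norm (cb_add a (cb_scal (- / 2 ^ tau) (cb_alpha X m))) - 2 * cb_norm a
  <= / 2 ^ (tau + k) / 4.
Proof.
  set (u := cb_alpha X j). set (x := cb_alpha X m). set (B := cb_norm x).
  assert (HB : 0 <= B) by apply norm_ge0.
  (* The [L] second differences sum to at most [2 t B]; with [L > 8 * 2 ^ k * B] one of them is at
     most [t / 2 ^ k / 4]. As [L] does not depend on [t], the step can then be made small enough to
     keep the whole walk near [u]. *)
  destruct (INR_unbounded (8 * 2 ^ k * B)) as [L HL].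
  destruct (half_pow_small (/ 2 ^ n / 4 / ((INR L + 1) * (B + 1)))) as [tau Htau].
  { assert (H := half_pow_pos n). assert (H' := pos_INR L).
    apply Rdiv_lt_0_compat; [lra|]. apply Rmult_lt_0_compat; lra. }
  set (t := / 2 ^ tau) in *. assert (Ht : 0 < t) by apply half_pow_pos.
  set (h := fun i => cb_norm (cb_add u (cb_scal (INR i * t) x))).
  assert (HL0 := pos_INR L). assert (Hk := half_pow_pos k).
  assert (Hlip : forall i, Rabs (h (S i) - h i) <= t * B).
  { intros i. eapply Rle_trans; [apply norm_abs_tri|]. right.
    replace (vsub _ _) with (cb_scal t x) by (rewrite S_INR; unfold vsub; vec).
    rewrite cb_normZ, Rabs_pos_eq by lra. reflexivity. }
  assert (Hex : exists i, (i < L)%nat /\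
    h (S (S i)) + h i - 2 * h (S i) <= t * / 2 ^ k / 4).
  { apply NNPP. intros Hno.
    assert (Sum := sum_second_diff h (t * / 2 ^ k / 4) L).
    assert (Hi : forall i, (i < L)%nat -> t * / 2 ^ k / 4 <= h (S (S i)) + h i - 2 * h (S i)).
    { intros i Hi. apply Rnot_lt_le. intros Hlt. apply Hno. exists i. split; [easy|lra]. }
    specialize (Sum Hi). assert (A1 := Rabs_le_inv _ _ (Hlip L)).
    assert (A2 := Rabs_le_inv _ _ (Hlip 0%nat)).
    assert (Hc : INR L * / 2 ^ k <= 8 * B) by (apply (Rmult_le_reg_l t); lra).
    apply (Rmult_le_compat_l (2 ^ k)) in Hc; [|apply pow_le; lra].
    replace (2 ^ k * (INR L * / 2 ^ k)) with (INR L) in Hc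
      by (field; apply pow_nonzero; lra).
    lra. }
  destruct Hex as (i & HiL & Hi). exists (S i), tau.
  assert (Ha : INR (S i) / 2 ^ tau = INR (S i) * t) by reflexivity.
  cbv zeta. rewrite Ha. fold t. split.
  - replace (vsub _ _) with (cb_scal (INR (S i) * t) x) by (unfold vsub; vec).
    assert (Hi' : 0 <= INR (S i) <= INR L) by (split; [apply pos_INR|apply le_INR; lia]).
    rewrite cb_normZ, Rabs_pos_eq by nra. fold B.
    apply (Rmult_lt_compat_r ((INR L + 1) * (B + 1))) in Htau;
      [|apply Rmult_lt_0_compat; lra].
    replace (/ 2 ^ n / 4 / ((INR L + 1) * (B + 1)) * ((INR L + 1) * (B + 1)))
      with (/ 2 ^ n / 4) in Htau by (field; repeat split; try apply pow_nonzero; lra).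
    assert (INR (S i) * B <= (INR L + 1) * (B + 1)) by nra.
    assert (t * (INR (S i) * B) <= t * ((INR L + 1) * (B + 1)))
      by (apply Rmult_le_compat_l; lra).
    lra.
  - rewrite half_pow_add. fold t. eapply Rle_trans; [|exact Hi]. right. unfold h.
    rewrite (S_INR (S i)), (S_INR i). f_equal. f_equal; f_equal; vec.
Qed.

(** * A computable functional *)

Definition lc_step (j tau m : nat) : nat := lc j (qmk 1 0 (2 ^ tau)) m.
Definition lc_back (j tau m : nat) : nat := lc j (qmk 0 1 (2 ^ tau)) m.
#[local] Instance lc_step_code : code3 lc_step.
Proof. eexists; intros p x y z. unfold lc_step. ev_auto. Qed.
#[local] Instance lc_back_code : code3 lc_back.
Proof. eexists; intros p x y z. unfold lc_back. ev_auto. Qed.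

Lemma pow2_pos n : (0 < 2 ^ n)%nat.
Proof. assert (H := Nat.pow_nonzero 2 n). lia. Qed.

Section Steps.
Context {X : CompBanach}.
Lemma alpha_step j tau m :
  cb_alpha X (lc_step j tau m)
  = cb_add (cb_alpha X j) (cb_scal (/ 2 ^ tau) (cb_alpha X m)).
Proof.
  unfold lc_step. rewrite alpha_lc, qval_qmk, pow2_INR by apply pow2_pos.
  do 2 f_equal. cbn [INR]. unfold Rdiv. ring.
Qed.
Lemma alpha_back j tau m :
  cb_alpha X (lc_back j tau m)
  = cb_add (cb_alpha X j) (cb_scal (- / 2 ^ tau) (cb_alpha X m)).
Proof.
  unfold lc_back. rewrite alpha_lc, qval_qmk, pow2_INR by apply pow2_pos.
  do 2 f_equal. cbn [INR]. unfold Rdiv. ring.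
Qed.
End Steps.

(* [st] codes the ball of centre [alpha_(ufst st)] and radius [2^-(usnd st)]; stage
   [s = <m,k>] makes the norm [2^-k]-smooth in direction [alpha_m] on the next ball. The
   check vanishes if [w = <j',tau>] passes, [j'] being the new centre and [2^-tau] the step
   at which the second difference of the norm is at most [2^-(tau+k+1)]. *)
Definition ball_check (N : nat -> nat -> nat) (st s w : nat) : nat :=
  let j := ufst st in let n := usnd st in
  let m := ufst s in let k := usnd s in
  let j' := ufst w in let tau := usnd w in
  let P := (tau + k + 6)%nat in
  (N (lc_back j' 0 j) (n + 4) - 6
   + (N (lc_step j' tau m) P + N (lc_back j' tau m) P - (2 * N j' P + 24)))%nat.

Definition ball_wit (N : nat -> nat -> nat) (s st : nat) : nat := least (ball_check N st s).

(** The first radius is 1/2, so a centre of norm at least 1 keeps the limit away from zero. The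
    exponent [tau + k + n + 3] both shrinks the ball and makes it small against [2 ^ -(tau + k)], so
    that the smoothness found at the centre persists at the limit. *)
Definition ball (N : nat -> nat -> nat) (j0 s : nat) : nat :=
  nat_rect (fun _ => nat) (npair j0 1)
    (fun s st => npair (ufst (ball_wit N s st))
                       (usnd (ball_wit N s st) + usnd s + usnd st + 3))%nat s.

Section Ball.
Context {X : CompBanach} (N : nat -> nat -> nat) (j0 : nat).
Hypothesis HN : forall i k, Rabs (INR (N i k) - 2 ^ k * cb_norm (cb_alpha X i)) <= 2.

(** Real inequalities cannot be decided, so the check surely passes at 1/4 and is conclusive only
    for 1/2. The first pair of bounds scales to 4 and 8, with error 2 and threshold 6; the second to
    16 and 32, with error 2 + 2 + 4 and threshold 24. *)
Lemma ball_check_iff st s w (d := cb_norm (vsub (cb_alpha X (ufst w)) (cb_alpha X (ufst st))))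
  (D := cb_norm (cb_alpha X (lc_step (ufst w) (usnd w) (ufst s))) +
        cb_norm (cb_alpha X (lc_back (ufst w) (usnd w) (ufst s))) -
        2 * cb_norm (cb_alpha X (ufst w))) :
  (d <= / 2 ^ usnd st / 4 -> D <= / 2 ^ (usnd w + usnd s) / 4 -> ball_check N st s w = 0%nat) /\
  (ball_check N st s w = 0%nat -> d <= / 2 ^ usnd st / 2 /\ D <= / 2 ^ (usnd w + usnd s) / 2).
Proof.
  unfold ball_check. cbv zeta. set (j' := ufst w) in *. set (tau := usnd w) in *.
  set (j := ufst st) in *. set (n := usnd st) in *. set (m := ufst s) in *.
  set (k := usnd s) in *. set (P := (tau + k + 6)%nat).
  assert (E1 := Rabs_le_inv _ _ (HN (lc_back j' 0 j) (n + 4))).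
  assert (E2 := Rabs_le_inv _ _ (HN (lc_step j' tau m) P)).
  assert (E3 := Rabs_le_inv _ _ (HN (lc_back j' tau m) P)).
  assert (E4 := Rabs_le_inv _ _ (HN j' P)).
  (* With step [2 ^ 0], [lc_back] is plain subtraction. *)
  replace (cb_norm (cb_alpha X (lc_back j' 0 j))) with d in E1.
  2: { unfold d. f_equal. rewrite alpha_back. unfold vsub. cbn [pow]. vec. }
  assert (Hn : 0 < 2 ^ n) by (apply pow_lt; lra).
  assert (Hk : 0 < 2 ^ (tau + k)) by (apply pow_lt; lra).
  replace (2 ^ (n + 4)) with (16 * 2 ^ n) in E1 by (rewrite pow_add; ring).
  replace (2 ^ P) with (64 * 2 ^ (tau + k)) in E2, E3, E4
    by (unfold P; rewrite (pow_add 2 (tau + k) 6); ring).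
  split.
  - intros H1 H2.
    apply (Rmult_le_compat_l (16 * 2 ^ n)) in H1; [|lra].
    replace (16 * 2 ^ n * (/ 2 ^ n / 4)) with 4 in H1 by (field; lra).
    apply (Rmult_le_compat_l (64 * 2 ^ (tau + k))) in H2; [|lra].
    replace (64 * 2 ^ (tau + k) * (/ 2 ^ (tau + k) / 4)) with 16 in H2 by (field; lra).
    assert (A : (N (lc_back j' 0 j) (n + 4) <= 6)%nat).
    { apply INR_le. replace (INR 6) with 6 by (cbn; ring). lra. }
    assert (B : (N (lc_step j' tau m) P + N (lc_back j' tau m) P <= 2 * N j' P + 24)%nat).
    { apply INR_le. rewrite !plus_INR, mult_INR.
      replace (INR 24) with 24 by (cbn; ring). change (INR 2) with 2. unfold D in H2. lra. }
    lia.
  - intros H0.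
    assert (A : (N (lc_back j' 0 j) (n + 4) <= 6)%nat) by lia.
    assert (B : (N (lc_step j' tau m) P + N (lc_back j' tau m) P <= 2 * N j' P + 24)%nat) by lia.
    apply le_INR in A, B. rewrite !plus_INR, mult_INR in B.
    replace (INR 6) with 6 in A by (cbn; ring). replace (INR 24) with 24 in B by (cbn; ring).
    change (INR 2) with 2 in B. split.
    + apply (Rmult_le_reg_l (16 * 2 ^ n)); [lra|].
      replace (16 * 2 ^ n * (/ 2 ^ n / 2)) with 8 by (field; lra). lra.
    + apply (Rmult_le_reg_l (64 * 2 ^ (tau + k))); [lra|].
      replace (64 * 2 ^ (tau + k) * (/ 2 ^ (tau + k) / 2)) with 32 by (field; lra).
      unfold D. lra.
Qed.

Lemma ball_check_ex st s : exists w, ball_check N st s w = 0%nat.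
Proof.
  destruct (smooth_dense X (ufst st) (ufst s) (usnd st) (usnd s)) as (i & tau & H1 & H2).
  exists (npair (lc (ufst st) (qmk i 0 (2 ^ tau)) (ufst s)) tau).
  apply ball_check_iff; rewrite ufst_npair, ?usnd_npair, ?alpha_step, ?alpha_back, alpha_lc,
    qval_qmk, pow2_INR by apply pow2_pos; change (INR 0) with 0; rewrite Rminus_0_r; assumption.
Qed.

Definition ball_step (s : nat) : nat := ball_wit N s (ball N j0 s).

Lemma ball_step_code : code2 N -> code1 ball_step.
Proof.
  intros HcN.
  assert (Hc : code3 (ball_check N)).
  { eexists; intros p x y z. unfold ball_check. cbv zeta. ev_auto. }
  assert (Hw : code2 (ball_wit N)).
  { eexists; intros p x y. unfold ball_wit. ev_auto. apply ball_check_ex. }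
  assert (Hb : code1 (ball N j0)).
  { eexists; intros p x. unfold ball. ev_auto. }
  eexists; intros p x. unfold ball_step. ev_auto.
Qed.

Lemma ball_S s : ball N j0 (S s) =
  npair (ufst (ball_step s)) (usnd (ball_step s) + usnd s + usnd (ball N j0 s) + 3).
Proof. reflexivity. Qed.

Lemma ball_step_spec s :
  cb_norm (vsub (cb_alpha X (ufst (ball_step s))) (cb_alpha X (ufst (ball N j0 s))))
    <= / 2 ^ usnd (ball N j0 s) / 2 /\
  cb_norm (cb_alpha X (lc_step (ufst (ball_step s)) (usnd (ball_step s)) (ufst s))) +
  cb_norm (cb_alpha X (lc_back (ufst (ball_step s)) (usnd (ball_step s)) (ufst s))) -
  2 * cb_norm (cb_alpha X (ufst (ball_step s))) <= / 2 ^ (usnd (ball_step s) + usnd s) / 2.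
Proof.
  apply ball_check_iff. apply (least_spec (ball_check N (ball N j0 s) s)).
  apply ball_check_ex.
Qed.

Lemma ball_limit : exists u : X, forall s,
  cb_norm (vsub u (cb_alpha X (ufst (ball N j0 s)))) <= / 2 ^ usnd (ball N j0 s).
Proof.
  apply (nested_balls X (fun s => cb_alpha X (ufst (ball N j0 s)))
                        (fun s => / 2 ^ usnd (ball N j0 s))).
  - intros s. apply half_pow_pos.
  - intros s. rewrite ball_S, usnd_npair.
    eapply Rle_trans; [apply (half_pow_le (usnd (ball N j0 s) + 1)); lia|].
    rewrite half_pow_add. cbn [pow]. lra.
  - intros s. destruct (ball_step_spec s) as [H _]. rewrite ball_S, ufst_npair, usnd_npair.
    assert (/ 2 ^ (usnd (ball_step s) + usnd s + usnd (ball N j0 s) + 3)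
            <= / 2 ^ usnd (ball N j0 s) / 2); [|lra].
    eapply Rle_trans; [apply (half_pow_le (usnd (ball N j0 s) + 1)); lia|].
    rewrite half_pow_add. cbn [pow]. lra.
Qed.

Variable u : X.
Hypothesis Hu : forall s,
  cb_norm (vsub u (cb_alpha X (ufst (ball N j0 s)))) <= / 2 ^ usnd (ball N j0 s).

Lemma ball_next s (w := ball_step s) :
  cb_norm (vsub u (cb_alpha X (ufst w))) <= / 2 ^ usnd w * / 2 ^ usnd s / 8.
Proof.
  specialize (Hu (S s)). rewrite ball_S, ufst_npair, usnd_npair in Hu. fold w in Hu.
  eapply Rle_trans; [exact Hu|].
  eapply Rle_trans; [apply (half_pow_le (usnd w + usnd s + 3)); lia|].
  rewrite !half_pow_add. cbn [pow]. lra.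
Qed.

(** Moving from the centre to [u] changes the second difference by at most four times their
    distance, that is [t / 2 ^ k / 2] where [k = usnd s]; the centre itself accounts for the other
    half. *)
Lemma ball_smooth s (t := / 2 ^ usnd (ball_step s)) (x := cb_alpha X (ufst s)) :
  dquot u x t + dquot u (cb_opp x) t <= / 2 ^ usnd s.
Proof.
  destruct (ball_step_spec s) as [_ H]. rewrite alpha_step, alpha_back in H.
  assert (Hb := ball_next s). cbv zeta in Hb. fold t in H, Hb. fold x in H.
  set (a := cb_alpha X (ufst (ball_step s))) in *.
  assert (Ht : 0 < t) by apply half_pow_pos. rewrite half_pow_add in H. fold t in H.
  apply (Rmult_le_reg_l t); [easy|]. rewrite <- second_diff by easy.
  assert (T : forall r, cb_norm (cb_add u (cb_scal r x))
                        <= cb_norm (cb_add a (cb_scal r x)) + cb_norm (vsub u a)).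
  { intros r. eapply Rle_trans; [apply (norm_tri _ (cb_add a (cb_scal r x)))|].
    right. do 2 f_equal. unfold vsub. vec. }
  assert (T1 := T t). assert (T2 := T (- t)). assert (T3 := norm_tri a u).
  rewrite norm_sub_sym in T3. lra.
Qed.

Lemma ball_smooth_all m eps : 0 < eps -> exists t, 0 < t /\
  dquot u (cb_alpha X m) t + dquot u (cb_opp (cb_alpha X m)) t <= eps.
Proof.
  intros He. destruct (half_pow_small eps He) as [k Hk].
  assert (H := ball_smooth (npair m k)). rewrite ufst_npair, usnd_npair in H.
  eexists; split; [|eapply Rle_trans; [exact H|lra]]. apply half_pow_pos.
Qed.

(** Norms scaled by [2 ^ (tau + k + 6)] and divided by the step [2 ^ -tau] leave the denominator
    [2 ^ (k + 6)]. The quotient may be negative, hence two natural numbers. *)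
Definition approx_pos (m k : nat) : nat :=
  let w := ball_step (npair m k) in N (lc_step (ufst w) (usnd w) m) (usnd w + k + 6).
Definition approx_neg (m k : nat) : nat :=
  let w := ball_step (npair m k) in N (ufst w) (usnd w + k + 6).

(** The derivative lies between the right quotient and the negated quotient for the opposite
    direction, which differ by at most [/ 2 ^ k]. Replacing [u] by the centre and norms by integers
    costs at most half as much again. *)
Lemma gateaux_approx m k :
  Rabs (gateaux u (cb_alpha X m) - (INR (approx_pos m k) - INR (approx_neg m k)) / 2 ^ (k + 6))
  <= 2 * / 2 ^ k.
Proof.
  assert (Hs := ball_smooth (npair m k)). assert (Hb := ball_next (npair m k)).
  unfold approx_pos, approx_neg. cbv zeta in *. rewrite ufst_npair, usnd_npair in *.
  set (w := ball_step (npair m k)) in *. set (P := (usnd w + k + 6)%nat).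
  set (x := cb_alpha X m) in *. set (t := / 2 ^ usnd w) in *. set (a := cb_alpha X (ufst w)) in *.
  assert (Ht : 0 < t) by apply half_pow_pos.
  assert (L1 := gateaux_le u x t Ht). assert (L2 := gateaux_le u (cb_opp x) t Ht).
  rewrite gateaux_opp in L2 by exact ball_smooth_all.
  assert (E1 := Rabs_le_inv _ _ (HN (lc_step (ufst w) (usnd w) m) P)).
  assert (E2 := Rabs_le_inv _ _ (HN (ufst w) P)).
  rewrite alpha_step in E1. fold t x a in E1, E2.
  assert (T1 := norm_abs_tri (cb_add u (cb_scal t x)) (cb_add a (cb_scal t x))).
  replace (vsub (cb_add u (cb_scal t x)) (cb_add a (cb_scal t x))) with (vsub u a) in T1
    by (unfold vsub; vec).
  assert (T2 := norm_abs_tri u a). apply Rabs_le_inv in T1, T2.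
  rewrite dquot_norm in T1 by easy.
  set (n1 := INR (N (lc_step (ufst w) (usnd w) m) P)) in *. set (n2 := INR (N (ufst w) P)) in *.
  set (K := / 2 ^ k) in *. assert (HK : 0 < K) by apply half_pow_pos.
  assert (Hk2 : 0 < 2 ^ k) by (apply pow_lt; lra).
  assert (HKk : K * 2 ^ k = 1) by (apply Rinv_l; lra).
  assert (HP : 2 ^ P * (t * K) = 64).
  { unfold P, t, K. rewrite !pow_add. field. split; apply pow_nonzero; lra. }
  assert (HtK : 0 < t * K) by now apply Rmult_lt_0_compat.
  assert (Hn : forall b : R, forall n : R, - (2) <= n - 2 ^ P * b <= 2 ->
             - t * K <= 32 * (n * (t * K) / 64 - b) <= t * K).
  { intros b n Hbn.
    replace (32 * (n * (t * K) / 64 - b)) with ((n - 2 ^ P * b) * (t * K) / 2); [nra|].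
    replace (32 * (n * (t * K) / 64 - b)) with (n * (t * K) / 2 - b * 64 / 2) by field.
    rewrite <- HP. field. }
  apply Hn in E1, E2.
  replace ((n1 - n2) / 2 ^ (k + 6)) with ((n1 - n2) * K / 64)
    by (unfold K; rewrite pow_add; field; lra).
  set (v := (n1 - n2) * K / 64).
  assert (Hv : t * v = n1 * (t * K) / 64 - n2 * (t * K) / 64) by (unfold v; field).
  assert (- (t * K) / 2 <= t * (dquot u x t - v) <= t * K / 2) by (split; lra).
  assert (- K / 2 <= dquot u x t - v <= K / 2).
  { split; apply (Rmult_le_reg_l t); lra. }
  apply Rabs_le. lra.
Qed.

Lemma approx_code : code2 N -> code2 approx_pos * code2 approx_neg.
Proof.
  intros HcN. assert (Hs := ball_step_code HcN).
  split; eexists; intros p x y; unfold approx_pos, approx_neg; cbv zeta; ev_auto.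
Qed.
End Ball.

Lemma alpha_norm_ge1 (X : CompBanach) :
  (exists x : X, x <> cb_zero) -> exists j, 1 <= cb_norm (cb_alpha X j).
Proof.
  intros [x Hx]. apply norm_pos in Hx.
  destruct (alpha_dense (cb_scal (2 / cb_norm x) x) 1 ltac:(lra)) as [j Hj]. exists j.
  assert (T := norm_tri (cb_scal (2 / cb_norm x) x) (cb_alpha X j)).
  rewrite norm_sub_sym, cb_normZ, Rabs_pos_eq in T
    by (left; apply Rdiv_lt_0_compat; lra).
  replace (2 / cb_norm x * cb_norm x) with 2 in T by (field; lra). lra.
Qed.

(** The point [u] and [phi] come from classical completeness; only the approximations [A] and [B] at
    dense points carry codes. The vector [v] is [u] normalised. *)
Lemma computable_functional (X : CompBanach) : (exists x : X, x <> cb_zero) ->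
  exists (phi : X -> R) (A B : nat -> nat -> nat),
    inhabited (code2 A) /\ inhabited (code2 B) /\
    (forall x y, phi (cb_add x y) = phi x + phi y) /\
    (forall a x, phi (cb_scal a x) = a * phi x) /\
    (forall x, Rabs (phi x) <= cb_norm x) /\
    (exists v, cb_norm v <= 1 /\ phi v = 1) /\
    (forall m k, Rabs (phi (cb_alpha X m) - (INR (A m k) - INR (B m k)) / 2 ^ (k + 6))
                 <= 2 * / 2 ^ k).
Proof.
  intros HX. destruct (alpha_norm_ge1 X HX) as [j0 Hj0].
  destruct (norm_approx X) as [N HcN HN].
  destruct (ball_limit N j0 HN) as [u Hu].
  assert (Hsm := ball_smooth_all N j0 HN u Hu).
  destruct (approx_code N j0 HN HcN) as [HA HB].
  exists (gateaux u), (approx_pos N j0), (approx_neg N j0).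
  split; [now constructor|]. split; [now constructor|].
  split; [intros; now apply gateaux_add|]. split; [intros; now apply gateaux_scal|].
  split; [intros; now apply gateaux_abs|].
  split; [|intros; now apply gateaux_approx].
  assert (Hn : 0 < cb_norm u).
  { specialize (Hu 0%nat). unfold ball in Hu. cbn [nat_rect] in Hu.
    rewrite ufst_npair, usnd_npair in Hu. assert (T := norm_tri (cb_alpha X j0) u).
    rewrite norm_sub_sym in T. cbn [pow] in Hu. lra. }
  exists (cb_scal (/ cb_norm u) u). split.
  - rewrite cb_normZ, Rabs_pos_eq by (left; now apply Rinv_0_lt_compat).
    rewrite Rinv_l; lra.
  - rewrite gateaux_scal by exact Hsm. rewrite gateaux_self. apply Rinv_l. lra.
Qed.

(** * Reducing closed choice to uniform boundedness *)

Definition eqn (x y : nat) : nat := (1 - ((x - y) + (y - x)))%nat.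
Definition seen (p : Baire) (i n : nat) : nat :=
  nat_rect (fun _ => nat) 0%nat (fun j a => a + eqn (p j) (S n))%nat i.
Definition guess (p : Baire) (i : nat) : nat := least (seen p i).
(* Nonzero, and larger than [i], exactly when stage [i] refutes the current guess. *)
Definition jump (p : Baire) (i : nat) : nat := (S i * eqn (p i) (S (guess p i)))%nat.

Lemma seen_0 p i n : seen p i n = 0%nat <-> forall j, (j < i)%nat -> p j <> S n.
Proof.
  induction i as [|i IH]; [split; [lia|reflexivity]|].
  change (seen p (S i) n) with (seen p i n + eqn (p i) (S n))%nat. unfold eqn. split.
  - intros H j Hj. destruct (Nat.eq_dec j i) as [->|]; [lia|]. apply IH; lia.
  - intros H. assert (H1 := H i ltac:(lia)).
    assert (seen p i n = 0%nat) by (apply IH; intros; apply H; lia). lia.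
Qed.

Lemma seen_ex p i : exists n, seen p i n = 0%nat.
Proof.
  assert (H : exists b, forall j, (j < i)%nat -> (p j <= b)%nat).
  { induction i as [|i [b Hb]]; [exists 0%nat; lia|]. exists (b + p i)%nat. intros j Hj.
    destruct (Nat.eq_dec j i) as [->|]; [lia|]. specialize (Hb j ltac:(lia)). lia. }
  destruct H as [b Hb]. exists b. apply seen_0. intros j Hj E. specialize (Hb j Hj). lia.
Qed.

Lemma guess_unseen p i j : (j < i)%nat -> p j <> S (guess p i).
Proof. revert j. apply seen_0. apply (least_spec (seen p i)). apply seen_ex. Qed.

Lemma guess_le p i n : (forall j, p j <> S n) -> (guess p i <= n)%nat.
Proof.
  intros H. apply Nat.nlt_ge. intros Hlt.
  apply (proj2 (least_spec (seen p i) (seen_ex p i)) n Hlt). apply seen_0. intros. apply H.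
Qed.

Lemma jump_0 p i : jump p i = 0%nat \/ p i = S (guess p i) /\ jump p i = S i.
Proof. unfold jump, eqn. destruct (Nat.eq_dec (p i) (S (guess p i))) as [E|E]; nia. Qed.

(** The guess never exceeds a member [a], and a refuted number is never guessed again, so only
    finitely many stages refute the current guess. *)
Lemma jump_bounded p a : (forall j, p j <> S a) -> exists b, forall i, (jump p i <= b)%nat.
Proof.
  intros Ha.
  assert (H : forall c, exists I, forall i, (I <= i)%nat -> (guess p i < c)%nat ->
                                  p i <> S (guess p i)).
  { induction c as [|c [I HI]]; [exists 0%nat; lia|].
    destruct (classic (exists i, p i = S c)) as [[i0 Hi0]|Hno].
    - exists (I + S i0)%nat. intros i Hi Hg.
      destruct (Nat.eq_dec (guess p i) c) as [E|E]; [|apply HI; lia].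
      exfalso. apply (guess_unseen p i i0 ltac:(lia)). congruence.
    - exists I. intros i Hi Hg E. destruct (Nat.eq_dec (guess p i) c) as [E'|E'].
      + apply Hno. exists i. congruence.
      + apply (HI i); lia || easy. }
  destruct (H (S a)) as [I HI]. exists I. intros i.
  destruct (jump_0 p i) as [->|[E ->]]; [lia|].
  apply Nat.nlt_ge. intros Hlt. apply (HI i ltac:(lia)); [|easy].
  assert (G := guess_le p i a Ha). lia.
Qed.

(** A refutation at a stage [i >= M] would give a jump of height [i + 1 > M]. The guess is therefore
    constant from [M] on, unrefuted before [M] by its choice and afterwards by the absence of
    jumps. *)
Lemma guess_stable p M : (forall i, (jump p i <= M)%nat) -> forall j, p j <> S (guess p M).
Proof.
  intros HM.
  assert (Hj : forall i, (M <= i)%nat -> p i <> S (guess p i)).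
  { intros i Hi E. specialize (HM i). unfold jump, eqn in HM. rewrite E in HM. nia. }
  assert (Hg : forall d, guess p (d + M) = guess p M).
  { induction d as [|d IH]; [easy|]. rewrite <- IH.
    assert (Hd := Hj (d + M)%nat ltac:(lia)).
    destruct (least_spec (seen p (d + M)) (seen_ex p _)) as [L1 L2].
    destruct (least_spec (seen p (S d + M)) (seen_ex p _)) as [K1 K2].
    fold (guess p (d + M)) in L1, L2. fold (guess p (S d + M)) in K1, K2.
    rewrite seen_0 in L1, K1.
    destruct (Nat.lt_trichotomy (guess p (S d + M)) (guess p (d + M))) as [H|[H|H]]; [|easy|].
    - exfalso. apply (L2 _ H). apply seen_0. intros j Hj'. apply K1. lia.
    - exfalso. apply (K2 _ H). apply seen_0. intros j Hj'.
      destruct (Nat.eq_dec j (d + M)) as [->|]; [easy|]. apply L1. lia. }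
  intros j. destruct (Nat.lt_ge_cases j M) as [H|H]; [now apply guess_unseen|].
  replace (guess p M) with (guess p j); [now apply Hj|].
  rewrite <- (Hg (j - M)%nat). f_equal. lia.
Qed.

(* With [phi(alpha_m)] approximated by [(A m l - B m l) / 2^(l+6)] and [|alpha_y| <= b], an
   associate of [x |-> jump p i * phi x * alpha_y] for all [i]: the [n]-th output is read
   off the [l]-th term of the input. *)
Definition op_prec (b : nat) (p : Baire) (i n : nat) : nat := (n + 3 * b * jump p i)%nat.
Definition op_out (A B : nat -> nat -> nat) (b y : nat) (p : Baire) (i n m : nat) : nat :=
  let l := op_prec b p i n in
  lc 0 (qmk (jump p i * A m l) (jump p i * B m l) (2 ^ (l + 6))) y.
Definition op_name (A B : nat -> nat -> nat) (b y : nat) (p : Baire) (z : nat) : nat :=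
  let i := ufst z in let n := ufst (usnd z) in let w := usnd (usnd z) in
  let l := op_prec b p i n in
  ((1 - (1 - ndrop w l)) * S (op_out A B b y p i n (nnth w l)))%nat.

(** The function depends on the oracle, so it has no [code1] instance and is composed by hand where
    [ev_auto] stops. *)
Lemma guess_code : {c | forall p i, ev p c [i] (guess p i)}.
Proof.
  eexists; intros p i. unfold guess, seen, eqn. ev_auto.
  destruct (seen_ex p i) as [n Hn]. exists n. exact Hn.
Qed.

(** For the outer map, whose oracle is a pair: the name of the set sits at the even positions, the
    bound at position 1. *)
Lemma guess_even_code : {c | forall z i, ev z c [i] (guess (fun k => z (k + k)%nat) i)}.
Proof.
  eexists; intros z i. unfold guess, seen, eqn. ev_auto.
  destruct (seen_ex (fun k => z (k + k)%nat) i) as [n Hn]. exists n. exact Hn.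
Qed.

Lemma jump_code : {c | forall p i, ev p c [i] (jump p i)}.
Proof.
  eexists; intros p i. unfold jump, eqn. ev_auto;
    eapply (ev_comp1 _ _ _ _ _ _ (proj2_sig guess_code p)); ev_auto.
Qed.

Lemma op_name_code A B b y : code2 A -> code2 B ->
  {c | forall p z, ev p c [z] (op_name A B b y p z)}.
Proof.
  intros HA HB. eexists; intros p z. unfold op_name, op_out, op_prec. cbv zeta.
  ev_auto; eapply (ev_comp1 _ _ _ _ _ _ (proj2_sig jump_code p)); ev_auto.
Qed.

Lemma prefix_length q k : length (prefix q k) = k.
Proof. unfold prefix. now rewrite length_map, length_seq. Qed.
Lemma prefix_nth q k l : (l < k)%nat -> nth l (prefix q k) 0%nat = q l.
Proof.
  intros H. unfold prefix. rewrite (nth_indep _ 0%nat (q 0%nat)).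
  - rewrite map_nth. f_equal. rewrite seq_nth by easy. reflexivity.
  - now rewrite length_map, length_seq.
Qed.

(** [ndrop w l] is nonzero exactly when the prefix has more than [l] entries, so the associate stays
    silent until term [l] of the input is available. *)
Lemma op_name_eta A B b y p i q :
  eta (bproj (op_name A B b y p) i) q
      (fun n => op_out A B b y p i n (q (op_prec b p i n))).
Proof.
  intros n. set (l := op_prec b p i n). exists (S l). split.
  - unfold bproj, op_name. repeat rewrite ?ufst_npair, ?usnd_npair. cbv zeta. fold l.
    rewrite nnth_enc, prefix_nth by lia. rewrite ndrop_enc.
    assert (H : length (skipn l (prefix q (S l))) = 1%nat)
      by (rewrite length_skipn, prefix_length; lia).
    destruct (skipn l (prefix q (S l))) as [|a s]; [easy|]. cbn [enc_list]. lia.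
  - intros k Hk. unfold bproj, op_name. repeat rewrite ?ufst_npair, ?usnd_npair. cbv zeta.
    fold l. rewrite ndrop_enc, skipn_all2 by (rewrite prefix_length; lia). reflexivity.
Qed.

Section Operators.
Context {X Y : CompBanach} (phi : X -> R) (A B : nat -> nat -> nat) (b y : nat).
Hypothesis phi_add : forall x x', phi (cb_add x x') = phi x + phi x'.
Hypothesis phi_scal : forall a x, phi (cb_scal a x) = a * phi x.
Hypothesis phi_abs : forall x, Rabs (phi x) <= cb_norm x.
Hypothesis phi_approx : forall m k,
  Rabs (phi (cb_alpha X m) - (INR (A m k) - INR (B m k)) / 2 ^ (k + 6)) <= 2 * / 2 ^ k.
Hypothesis y_le : cb_norm (cb_alpha Y y) <= INR b.

Definition op (p : Baire) (i : nat) (x : X) : Y :=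
  cb_scal (INR (jump p i) * phi x) (cb_alpha Y y).

Lemma op_norm p i x : cb_norm (op p i x) = INR (jump p i) * Rabs (phi x) * cb_norm (cb_alpha Y y).
Proof.
  unfold op. now rewrite cb_normZ, Rabs_mult, (Rabs_pos_eq (INR _)) by apply pos_INR.
Qed.

Lemma op_linear p i : is_linear X Y (op p i).
Proof.
  split; intros; unfold op; [rewrite phi_add|rewrite phi_scal]; vec.
Qed.

Lemma op_bound p i x : cb_norm (op p i x) <= INR (jump p i) * INR b * cb_norm x.
Proof.
  rewrite op_norm. assert (H := phi_abs x). assert (H0 := pos_INR (jump p i)).
  assert (H1 := Rabs_pos (phi x)). assert (H2 := norm_ge0 (cb_alpha Y y)).
  rewrite !Rmult_assoc. apply Rmult_le_compat_l; [easy|]. rewrite (Rmult_comm (INR b)).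
  now apply Rmult_le_compat.
Qed.

(** The input contributes [/ 2 ^ l] and the approximation of [phi] twice that, scaled by at most
    [c * b] for the jump height [c]. Precision [l = n + 3 * b * c] absorbs the factor because a
    number is at most its power of two. *)
Lemma op_delta p i : delta_fun X Y (bproj (op_name A B b y p) i) (op p i).
Proof.
  intros q x Hq. eexists. split; [apply op_name_eta|]. intros n.
  set (l := op_prec b p i n). set (m := q l). set (c := jump p i).
  unfold cb_dist, op_out. cbv zeta. fold l c. rewrite alpha_lc, alpha_0, qval_qmk by apply pow2_pos.
  rewrite !mult_INR, pow2_INR. unfold op. fold c. set (e := cb_alpha Y y) in *.
  set (v := (INR c * INR (A m l) - INR c * INR (B m l)) / 2 ^ (l + 6)).
  replace (cb_add (cb_add cb_zero (cb_scal v e)) (cb_opp (cb_scal (INR c * phi x) e)))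
    with (cb_scal (v - INR c * phi x) e) by vec.
  rewrite cb_normZ. set (v' := (INR (A m l) - INR (B m l)) / 2 ^ (l + 6)).
  assert (Hv : v = INR c * v') by (unfold v, v'; field; apply pow_nonzero; lra).
  assert (Hp : Rabs (phi x - v') <= 3 * / 2 ^ l).
  { assert (H1 := phi_approx m l). fold v' in H1.
    assert (H2 := Hq l). unfold cb_dist in H2. fold m in H2.
    assert (H3 := phi_abs (cb_add (cb_alpha X m) (cb_opp x))).
    rewrite phi_add, voppE, phi_scal in H3. rewrite voppE in H2.
    apply Rabs_le_inv in H1.
    assert (H4 : Rabs (phi (cb_alpha X m) + -1 * phi x) <= / 2 ^ l) by lra.
    apply Rabs_le_inv in H4. apply Rabs_le. lra. }
  rewrite Hv, <- Rmult_minus_distr_l, Rabs_mult, Rabs_minus_sym, (Rabs_pos_eq (INR c))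
    by apply pos_INR.
  assert (Hc := pos_INR c). assert (Hb := pos_INR b). assert (Hl := half_pow_pos l).
  assert (He := norm_ge0 e). assert (HP := Rabs_pos (phi x - v')).
  apply Rle_trans with (INR c * (3 * / 2 ^ l) * INR b).
  { apply Rmult_le_compat; try easy; [|now apply Rmult_le_compat_l].
    now apply Rmult_le_pos. }
  assert (Hd := INR_le_pow2 (3 * b * c)).
  assert (El : / 2 ^ l = / 2 ^ n * / 2 ^ (3 * b * c)) by (rewrite <- half_pow_add; reflexivity).
  rewrite El, !mult_INR in *. change (INR 3) with (1 + 1 + 1) in Hd.
  assert (Hn := half_pow_pos n). assert (Hg := half_pow_pos (3 * b * c)).
  assert (Hg1 : INR (3 * b * c) * / 2 ^ (3 * b * c) <= 1).
  { rewrite <- (Rinv_r (2 ^ (3 * b * c))) by (apply pow_nonzero; lra).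
    apply Rmult_le_compat_r; [lra|apply INR_le_pow2]. }
  rewrite !mult_INR in Hg1. change (INR 3) with (1 + 1 + 1) in Hg1.
  set (g := / 2 ^ (3 * b * c)) in *. set (h := / 2 ^ n) in *.
  replace (INR c * (3 * (h * g)) * INR b) with (h * ((1 + 1 + 1) * INR b * INR c * g)) by ring.
  rewrite <- (Rmult_1_r h) at 2. apply Rmult_le_compat_l; lra.
Qed.
End Operators.

Lemma CN_le_UBT (X Y : CompBanach) :
  (exists x : X, x <> cb_zero) -> (exists y : Y, y <> cb_zero) ->
  weihrauch_le C_N (UBT X Y).
Proof.
  intros HX HY.
  destruct (computable_functional X HX)
    as (phi & A & B & [HA] & [HB] & Hadd & Hscal & Habs & (v & Hv & Hphi) & Happ).
  destruct (alpha_norm_ge1 Y HY) as [y Hy].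
  destruct (INR_unbounded (cb_norm (cb_alpha Y y))) as [b Hb]. apply Rlt_le in Hb.
  exists (fun z => Some (fun _ => guess (fun k => z (k + k)%nat) (z 1%nat))).
  exists (fun p => Some (op_name A B b y p)).
  split; [|split].
  - assert (E : {c | forall z n, ev z c [n] (guess (fun k => z (k + k)%nat) (z 1%nat))}).
    { eexists; intros z n.
      eapply (ev_comp1 _ _ _ _ _ _ (proj2_sig guess_even_code z)). ev_auto. }
    destruct E as [c Hc]. exists c. intros z q [= <-] n. apply Hc.
  - destruct (op_name_code A B b y HA HB) as [c Hc]. exists c. intros p q [= <-] n. apply Hc.
  - intros G HG p S HS [a Ha]. cbn in HS.
    assert (HSp : forall n, S n <-> forall j, p j <> Datatypes.S n).
    { intros n. split.
      - intros H j E. apply (proj2 (HS n)); [now exists j|easy].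
      - intros H. apply NNPP. intros Hn. apply HS in Hn. destruct Hn as [j Hj].
        now apply (H j). }
    destruct (HG (op_name A B b y p) (op phi y p)) as (r & Hr & M & HrM & HM).
    + intros i. now apply op_delta.
    + destruct (jump_bounded p a) as [c Hc]; [now apply HSp|]. split.
      * intros i. split; [now apply op_linear|]. exists (INR (jump p i) * INR b).
        intros x. now apply op_bound.
      * intros x. exists (INR c * INR b * cb_norm x). intros i.
        eapply Rle_trans; [exact (op_bound phi b y Habs Hb p i x)|].
        apply Rmult_le_compat_r; [apply norm_ge0|].
        apply Rmult_le_compat_r; [apply pos_INR|]. now apply le_INR.
    + cbn [obind]. rewrite Hr. cbn [obind]. eexists. split; [reflexivity|].
      exists (guess p M). split.
      * cbn in HrM |- *. rewrite HrM. f_equal. apply functional_extensionality. intros k.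
        unfold bpair. replace (k + k)%nat with (2 * k)%nat by lia.
        now rewrite Nat.even_even, Nat.div2_double.
      (* Testing the bound at [v] suffices: the image has norm [jump p i] times the norm of
         [alpha_y], which is at least 1. *)
      * apply HSp. apply guess_stable. intros i. apply INR_le.
        eapply Rle_trans; [|exact (HM i v Hv)].
        rewrite op_norm, Hphi, Rabs_R1, Rmult_1_r.
        assert (H := pos_INR (jump p i)). nra.
Qed.

#[local] Arguments cb_zero : clear implicits.

Theorem theorem5p6 (X Y : CompBanach) :
  (exists x : X, x <> cb_zero X) -> (exists y : Y, y <> cb_zero Y) ->
  weihrauch_eq (UBT X Y) C_N.
Proof.
  intros HX HY. split; [apply UBT_le_CN|now apply CN_le_UBT].
Qed.
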